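(* Let $\mathcal{L}_n$ be the set of all Latin squares of order $n$, viewed as a family of subsets of $\Omega=\{1,\dots,n\}^3$. Then the recursive teaching dimension of $\mathcal{L}_n$ is at least $n^2-(e+o(1))n^{5/3}$, where $o(1)$ denotes a quantity tending to $0$ as $n\to\infty$.
   Context: A Latin square of order $n$ is an $n\times n$ array filled with elements of $\{1,\dots,n\}$ such that every element occurs exactly once in each row and each column; it is identified with the set of triples $(i,j,k)\in\{1,\dots,n\}^3$ such that the $(i,j)$-th entry equals $k$. For a family (concept class) $\mathcal{C}$ of subsets of a finite set $\Omega$ and $c\in\mathcal{C}$, a set $S\subseteq\Omega$ is a teaching set for $c$ with respect to $\mathcal{C}$ if $c\cap S\ne c'\cap S$ for every $c'\in\mathcal{C}$ with $c'\ne c$; $\mathrm{TD}(c;\mathcal{C})$ is the minimum size of such a teaching set. Define $\mathrm{TD}_{\min}(\mathcal{C})=\min_{c\in\mathcal{C}}\mathrm{TD}(c;\mathcal{C})$ and the recursive teaching dimension $\mathrm{RTD}(\mathcal{C})=\max_{\mathcal{C}'\subseteq\mathcal{C}}\mathrm{TD}_{\min}(\mathcal{C}')$, the maximum being over nonempty subfamilies $\mathcal{C}'$. *)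

(* Defs.v *)
From mathcomp Require Import all_boot all_algebra.

Set Implicit Arguments.
Unset Strict Implicit.
Unset Printing Implicit Defensive.

Section Teaching.
Variable Omega : finType.
Implicit Types (C : {set {set Omega}}) (c S : {set Omega}).

Definition teaching_set C c S : bool :=
  [forall c' in C, (c' != c) ==> (c :&: S != c' :&: S)].

(* The whole domain is always a teaching set, so this minimum is attained. *)
Lemma teaching_setT C c : teaching_set C c [set: Omega].
Proof.
apply/forall_inP => c' _; apply/implyP.
by rewrite !setIT eq_sym.
Qed.

(* Both minima start from #|Omega|, an upper bound of every value involved;
   TDmin is thus the true minimum as soon as C is nonempty. *)
Definition TD C c : nat :=
  \big[minn/#|Omega|]_(S : {set Omega} | teaching_set C c S) #|S|.

Definition TDmin C : nat := \big[minn/#|Omega|]_(c in C) TD C c.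

Definition RTD C : nat :=
  \max_(C' : {set {set Omega}} | (C' \subset C) && (C' != set0)) TDmin C'.

End Teaching.

(* Rows, columns and symbols are indexed by 'I_n = {0, ..., n-1}. *)
Definition is_latin (n : nat) (L : 'M['I_n]_n) : bool :=
  [forall i : 'I_n, forall k : 'I_n, #|[set j : 'I_n | L i j == k]| == 1] &&
  [forall j : 'I_n, forall k : 'I_n, #|[set i : 'I_n | L i j == k]| == 1].

Definition cells (n : nat) (L : 'M['I_n]_n) : {set 'I_n * 'I_n * 'I_n} :=
  [set t : 'I_n * 'I_n * 'I_n | L t.1.1 t.1.2 == t.2].

Definition latin_squares (n : nat) : {set {set 'I_n * 'I_n * 'I_n}} :=
  [set cells L | L : 'M['I_n]_n & is_latin L].

(* Main.v *)
Require Import Defs.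
From mathcomp Require Import all_boot all_order all_algebra.
From mathcomp Require Import zify ring lra.

(** Suppose RTD <= k = n^2 - m.  Peeling off the Latin squares one at a time, each
is assigned a set of k of its cells contained in none of the squares still
present, so there are at most as many Latin squares as partial Latin squares of
size k having a completion.  (Negative examples are no better than positive ones:
(i,j,k') not in L may be replaced by (i,j,L(i,j)).)

A lower bound on the number of Latin squares comes from filling the rows one after
the other: the d-regular bipartite graph available for the next row has at least
(d/e)^n perfect matchings, so there are at least (n!/e^n)^n >= n^(n^2) e^(-2n^2)
Latin squares.  The bound per A >= e^-n for doubly stochastic A follows from
Gurvits' capacity argument, for which log-concavity, that is the
Alexandrov-Fenchel inequality for permanents, suffices.

An upper bound on the partial Latin squares with a given set of filled cells comes
from applying Bregman's inequality to each row, padded with all-one rows.  By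
convexity it is largest when the m empty cells are equidistributed, and multiplying
by the number C(n^2, m) of patterns yields in total
n^(n^2) e^(-2n^2) exp(m (3 + 5 ln n - 3 ln m) + O(n ln^2 n)).
This is smaller than the lower bound once m exceeds e n^(5/3) + O(n^(4/3)). *)

Set Implicit Arguments.
Unset Strict Implicit.
Unset Printing Implicit Defensive.

Import Order.TTheory GRing.Theory Num.Theory.

(** * Permanents and the Alexandrov-Fenchel inequality *)

Local Open Scope ring_scope.

Section ListPermanent.
Variables (R : comNzRingType) (I : finType).
Implicit Types (a b u v x : I -> R) (l : seq (I -> R)) (V : {set I}).

(* The sum, over the injections f of the positions of l into V, of the products
   of the entries l_j (f j). *)
Fixpoint lper l V : R :=
  if l is a :: l' then \sum_(i in V) a i * lper l' (V :\ i) else 1.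

Lemma lper_nil V : lper [::] V = 1.
Proof. by []. Qed.

Lemma lper_cons a l V : lper (a :: l) V = \sum_(i in V) a i * lper l (V :\ i).
Proof. by []. Qed.

Lemma setD1C V i j : V :\ i :\ j = V :\ j :\ i.
Proof. by rewrite !setDDl setUC. Qed.

Lemma lper_swap a b l V : lper (a :: b :: l) V = lper (b :: a :: l) V.
Proof.
rewrite /=; under eq_bigr do rewrite mulr_sumr.
rewrite (exchange_big_dep (mem V)) /=; last by move=> i j _; rewrite !inE => /andP[].
apply: eq_bigr => j jV; rewrite mulr_sumr; apply: eq_big => [i | i _].
  by rewrite !inE jV eq_sym andbT andbC.
by rewrite setD1C mulrCA.
Qed.

Lemma lper_move l1 x l2 V : lper (l1 ++ x :: l2) V = lper (x :: l1 ++ l2) V.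
Proof.
elim: l1 V => [//|b l1 IH] V; rewrite lper_swap /=.
by apply: eq_bigr => i _; rewrite IH.
Qed.

Lemma lper_lin u v t l V :
  lper ((fun i => u i + t * v i) :: l) V = lper (u :: l) V + t * lper (v :: l) V.
Proof.
rewrite /= mulr_sumr -big_split /=; apply: eq_bigr => i _.
by rewrite mulrDl mulrA.
Qed.

Lemma lper_nseq n w V : #|V| = n ->
  lper (nseq n w) V = n`!%:R * \prod_(i in V) w i.
Proof.
elim: n V => [|n IH] V hV /=.
  by rewrite (cards0_eq hV) big_set0 fact0 mulr1.
under eq_bigr => i iV.
  have hV' : #|V :\ i| = n by move: hV; rewrite (cardsD1 i) iV => -[].
  rewrite (IH _ hV') mulrCA -(big_setD1 _ iV); over.
by rewrite sumr_const hV factS natrM -mulrA mulr_natl.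
Qed.

End ListPermanent.

Arguments lper : simpl never.

Definition ind (R : comNzRingType) (I : finType) (A : {set I}) (i : I) : R :=
  (i \in A)%:R.

Definition posv (R : realFieldType) (J : finType) (a : J -> R) : bool :=
  [forall i, 0 < a i].

Lemma posvP (R : realFieldType) (J : finType) (a : J -> R) :
  reflect (forall i, 0 < a i) (posv a).
Proof. exact: forallP. Qed.

Lemma lper_gt0 (R : realFieldType) (I : finType) (l : seq (I -> R)) (V : {set I}) :
  all (@posv R I) l -> (size l <= #|V|)%N -> 0 < lper l V.
Proof.
elim: l V => [|a l IH] V /=; first by rewrite lper_nil ltr01.
move=> /andP[/posvP ha hl] hV.
have [i iV] : exists i, i \in V by apply/card_gt0P; apply: leq_ltn_trans hV.
have hD j : j \in V -> 0 < a j * lper l (V :\ j).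
  move=> jV; rewrite mulr_gt0 //; apply: IH => //.
  by move: hV; rewrite (cardsD1 j) jV.
rewrite lper_cons (bigD1 i) //= ltr_pwDl ?hD //.
by apply: sumr_ge0 => j /andP[jV _]; apply/ltW/hD.
Qed.

(** * Perron's inequality and symmetric matrices with one positive direction *)

Section Lorentz.
Variables (R : realFieldType) (n : nat).
Variables (M : 'I_n -> 'I_n -> R) (a : 'I_n -> R).
Hypothesis Msym : forall i j, M i j = M j i.
Hypothesis M_ge0 : forall i j, 0 <= M i j.
Hypothesis M_gt0 : forall i j, i != j -> 0 < M i j.
Hypothesis a_gt0 : forall i, 0 < a i.

Let app (x : 'I_n -> R) i := \sum_j M i j * x j.
Let form (x y : 'I_n -> R) := \sum_i x i * app y i.

Hypothesis Ma_gt0 : forall i, 0 < app a i.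

Let formC x y : form x y = form y x.
Proof.
rewrite /form /app; under eq_bigr do rewrite mulr_sumr.
rewrite exchange_big; apply: eq_bigr => i _; rewrite mulr_sumr.
by apply: eq_bigr => j _; rewrite Msym; ring.
Qed.

(** By symmetry of M the two squares on the right contribute equally, and the cross terms give the
    form. A sum of nonnegative terms results: Perron's inequality follows, and since M is positive
    off the diagonal, equality forces w to be a multiple of a. *)
Let perron_eq w : \sum_i app a i * w i ^+ 2 / a i - form w w =
  2%:R^-1 * \sum_i \sum_j M i j * a i * a j * (w i / a i - w j / a j) ^+ 2.
Proof.
have e1 : \sum_i app a i * w i ^+ 2 / a i = \sum_i \sum_j M i j * a j * w i ^+ 2 / a i.
  by apply: eq_bigr => i _; rewrite /app !mulr_suml.
have e2 : \sum_i app a i * w i ^+ 2 / a i = \sum_i \sum_j M i j * a i * w j ^+ 2 / a j.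
  by rewrite e1 exchange_big; apply: eq_bigr => i _; apply: eq_bigr => j _; rewrite Msym.
have e3 : form w w = \sum_i \sum_j M i j * w i * w j.
  by apply: eq_bigr => i _; rewrite mulr_sumr; apply: eq_bigr => j _; ring.
set T := \sum_i app a i * _ / _.
have -> : T = 2%:R^-1 * (T + T) by field.
rewrite {1}/T e1 /T e2 e3.
have -> (x y z : R) : 2%:R^-1 * (x + y) - z = 2%:R^-1 * (x + y - z - z) by field.
congr (_ * _); rewrite -big_split -!sumrB /=; apply: eq_bigr => i _.
rewrite -big_split -!sumrB /=; apply: eq_bigr => j _.
have := a_gt0 i; have := a_gt0 j => /lt0r_neq0 ? /lt0r_neq0 ?.
by field; apply/andP.
Qed.

Let term_ge0 w i j : 0 <= M i j * a i * a j * (w i / a i - w j / a j) ^+ 2.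
Proof.
rewrite mulr_ge0 ?sqr_ge0 //; apply: mulr_ge0; last exact: ltW.
by apply: mulr_ge0 => //; apply: ltW.
Qed.

Let perron w : form w w <= \sum_i app a i * w i ^+ 2 / a i.
Proof.
rewrite -subr_ge0 perron_eq mulr_ge0 ?invr_ge0 //.
by apply: sumr_ge0 => i _; apply: sumr_ge0 => j _.
Qed.

Let perron_ker w : form w w = \sum_i app a i * w i ^+ 2 / a i ->
  forall i j, w i / a i = w j / a j.
Proof.
move=> /esym/eqP; rewrite -subr_eq0 perron_eq mulf_eq0 invr_eq0 pnatr_eq0 /=.
rewrite psumr_eq0 => [|i _]; last by apply: sumr_ge0.
move=> /allP h i j.
have := h i (mem_index_enum _); rewrite /= psumr_eq0 // => /allP /(_ j (mem_index_enum _)) /=.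
have [-> //|nij] := eqVneq i j.
rewrite mulf_eq0 sqrf_eq0 subr_eq0 (gt_eqF (mulr_gt0 _ _)) ?mulr_gt0 ?M_gt0 //.
by move=> /eqP.
Qed.

(** With D the diagonal matrix of (M a)_i / a_i, Perron's inequality makes D - M positive
    semidefinite with kernel spanned by a. The rank-one term (M a)(M a)^T is positive on a, so the
    sum is invertible. *)
Let kmx : 'M[R]_n :=
  \matrix_(i, j) ((i == j)%:R * (app a i / a i) - M i j + app a i * app a j).

Let kmx_mul (x : 'I_n -> R) j : ((\row_i x i) *m kmx) 0 j =
  app a j / a j * x j - app x j + app a j * \sum_i app a i * x i.
Proof.
rewrite mxE; under eq_bigr do rewrite !mxE mulrDr mulrBr.
rewrite big_split sumrB /=; congr (_ - _ + _).
- rewrite (bigD1 j) //= eqxx big1 ?addr0; first by rewrite mul1r mulrC.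
  by move=> i /negPf->; rewrite mul0r mulr0.
- by apply: eq_bigr => i _; rewrite Msym mulrC.
- by rewrite mulr_sumr; apply: eq_bigr => i _; ring.
Qed.

Let kmx_unit : kmx \in unitmx.
Proof.
rewrite -row_free_unit; apply: inj_row_free => r hr.
pose x i := r 0 i.
have rE : r = \row_i x i by apply/rowP => i; rewrite mxE.
rewrite rE in hr *; pose s := \sum_i app a i * x i.
have hk j : app a j / a j * x j - app x j + app a j * s = 0.
  by rewrite -kmx_mul hr mxE.
have : \sum_j x j * (app a j / a j * x j - app x j + app a j * s) = 0.
  by apply: big1 => j _; rewrite hk mulr0.
under eq_bigr do rewrite mulrDr mulrBr.
rewrite big_split sumrB /= -/(form x x).
have -> : \sum_j x j * (app a j / a j * x j) = \sum_i app a i * x i ^+ 2 / a i.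
  by apply: eq_bigr => j _; ring.
have -> : \sum_j x j * (app a j * s) = s ^+ 2.
  by under eq_bigr do rewrite mulrA (mulrC (x _)); rewrite -mulr_suml.
(* The Perron defect of x and s^2 are nonnegative with sum 0, so both vanish. *)
have := perron x; have := sqr_ge0 s => s2 pr e.
have s0 : s = 0 by apply/eqP; rewrite -sqrf_eq0; apply/eqP; lra.
have /perron_ker hc : form x x = \sum_i app a i * x i ^+ 2 / a i by lra.
apply/rowP => i; rewrite !mxE.
have xE j : x j = x i / a i * a j by rewrite (hc i j) mulfVK ?gt_eqF.
have : s = x i / a i * \sum_j app a j * a j.
  by rewrite /s mulr_sumr; apply: eq_bigr => j _; rewrite [x j]xE mulrCA.
rewrite s0 => /esym/eqP; rewrite mulf_eq0 mulf_eq0 invr_eq0 (gt_eqF (a_gt0 i)) orbF.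
case/orP => /eqP // h0; exfalso; have : 0 < \sum_j app a j * a j.
  rewrite (bigD1 i) //= ltr_pwDl ?mulr_gt0 //.
  by apply: sumr_ge0 => j _; rewrite mulr_ge0 ?ltW.
by rewrite h0 ltxx.
Qed.

(* With (A y)_i = a_i (M y)_i / (M a)_i, the hypothesis reads A <= A^2 and
   Perron's inequality reads A <= 1; solving z = y - A y gives the claim. *)
Lemma lorentz_form_le0 :
    (forall x, form x x <= \sum_i a i * app x i ^+ 2 / app a i) ->
  forall z, \sum_i app a i * z i = 0 -> form z z <= 0.
Proof.
move=> H z hz.
pose b := \row_i (app a i / a i * z i).
pose r := b *m invmx kmx; pose y i := r 0 i.
have rE : r = \row_i y i by apply/rowP => i; rewrite mxE.
pose s := \sum_i app a i * y i.
have hy j : app a j / a j * y j - app y j + app a j * s = app a j / a j * z j.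
  by rewrite -kmx_mul -rE mulmxKV ?kmx_unit // mxE.
have aMa : 0 <= form a a by apply: sumr_ge0 => i _; rewrite mulr_ge0 ?ltW.
(* Pair [hy] with a: D - M annihilates a and z is orthogonal to M a, so only s times the positive
   number (a, M a) remains. *)
have s0 : s = 0.
  have : \sum_j a j * (app a j / a j * y j - app y j + app a j * s) = 0.
    rewrite -[RHS]hz; apply: eq_bigr => j _; rewrite hy.
    by have := lt0r_neq0 (a_gt0 j) => ?; field.
  under eq_bigr do rewrite mulrDr mulrBr.
  rewrite big_split sumrB /= -/(form a y).
  have -> : \sum_j a j * (app a j / a j * y j) = s.
    by apply: eq_bigr => j _; have := lt0r_neq0 (a_gt0 j) => ?; field.
  have -> : form a y = s by rewrite formC; apply: eq_bigr => i _; rewrite mulrC.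
  rewrite subrr add0r; under eq_bigr do rewrite mulrA.
  rewrite -mulr_suml => /eqP; rewrite mulf_eq0 => /orP[/eqP h|/eqP //].
  rewrite /s big1 // => i _; exfalso; have : 0 < \sum_i a i * app a i.
    rewrite (bigD1 i) //= ltr_pwDl ?mulr_gt0 //.
    by apply: sumr_ge0 => j _; rewrite mulr_ge0 ?ltW.
  by rewrite h ltxx.
pose w i := a i * app y i / app a i.
have zE i : z i = y i - w i.
  have := hy i; rewrite s0 mulr0 addr0 /w.
  have := lt0r_neq0 (a_gt0 i); have := lt0r_neq0 (Ma_gt0 i) => m0 a0 e.
  have -> : z i = (app a i / a i * z i) * (a i / app a i) by field; apply/andP.
  by rewrite -e; field; apply/andP.
have appz i : app z i = app y i - app w i.
  by rewrite /app -sumrB; apply: eq_bigr => j _; rewrite zE mulrBr.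
(* Here w = A y. The difference of the first two terms is at most 0 by [H], and the parenthesis is
   at least 0 by [perron]. *)
have -> : form z z = form y y - form w y - (form w y - form w w).
  rewrite -{1}(formC y w) /form -!sumrB; apply: eq_bigr => i _.
  by rewrite appz zE; ring.
have wy : form w y = \sum_i a i * app y i ^+ 2 / app a i.
  by apply: eq_bigr => i _; rewrite /w; ring.
have ww : \sum_i app a i * w i ^+ 2 / a i = form w y.
  apply: eq_bigr => i _; rewrite /w.
  have := lt0r_neq0 (a_gt0 i); have := lt0r_neq0 (Ma_gt0 i) => m0 a0.
  by field; apply/andP.
have := H y; have := perron w; rewrite ww wy; lra.
Qed.

End Lorentz.

(** * Alexandrov-Fenchel by induction on the number of fixed vectors *)

Section AlexandrovFenchel.
Variables (R : realFieldType) (I : finType).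
Implicit Types (a b u v x y : I -> R) (l : seq (I -> R)) (V : {set I}).

(** Some z = v + c u is orthogonal to a. The quadratic polynomial in c given by the form at v + c u
    is then nonpositive at that c while its leading coefficient is positive, so its discriminant is
    nonnegative. *)
Lemma lper_AF_cone l V a :
    posv a -> all (@posv R I) l -> (size l).+2 = #|V| ->
    (forall z, lper [:: a, z & l] V = 0 -> lper [:: z, z & l] V <= 0) ->
  forall u v, posv u ->
    lper [:: u, u & l] V * lper [:: v, v & l] V <= lper [:: u, v & l] V ^+ 2.
Proof.
move=> ha hl hs H u v hu.
have au0 : 0 < lper [:: a, u & l] V by apply: lper_gt0; rewrite /= ?ha ?hu ?hs.
have uu0 : 0 < lper [:: u, u & l] V by apply: lper_gt0; rewrite /= ?hu ?hs.
pose c := - (lper [:: a, v & l] V / lper [:: a, u & l] V).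
pose z i := v i + c * u i.
have zE x : lper [:: z, x & l] V = lper [:: v, x & l] V + c * lper [:: u, x & l] V.
  exact: lper_lin.
have := H z; rewrite lper_swap !zE lper_swap (lper_swap u a).
rewrite /c mulNr divfK ?gt_eqF // subrr => /(_ erefl); rewrite -/c.
rewrite (lper_swap v z) (lper_swap u z) !zE (lper_swap v u).
set p := lper _ _ in uu0 *; set q := lper [:: u, v & l] V; set r := lper _ _.
move=> h; have : 0 <= (q + c * p) ^+ 2 by exact: sqr_ge0.
have : p * (r + c * q + c * (q + c * p)) <= 0 by rewrite pmulr_rle0.
nra.
Qed.

Lemma lper_AF2 V u v : #|V| = 2%N ->
  lper [:: u; u] V * lper [:: v; v] V <= lper [:: u; v] V ^+ 2.
Proof.
move=> /eqP/cards2P[i [j [nij ->]]].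
have E x y : lper [:: x; y] [set i; j] = x i * y j + x j * y i.
  rewrite lper_cons big_setU1 ?inE //= big_set1.
  have -> : [set i; j] :\ i = [set j].
    by apply/setP => k; rewrite !inE; case: eqVneq => // ->; rewrite (negPf nij).
  have -> : [set i; j] :\ j = [set i].
    apply/setP => k; rewrite !inE; case: eqVneq => // [->|_]; last by rewrite orbF.
    by rewrite eq_sym (negPf nij).
  by rewrite !lper_cons !big_set1 !lper_nil !mulr1.
rewrite !E -subr_ge0.
have -> : (u i * v j + u j * v i) ^+ 2 - (u i * u j + u j * u i) * (v i * v j + v j * v i)
  = (u i * v j - u j * v i) ^+ 2 by ring.
exact: sqr_ge0.
Qed.

Section Step.
Variables (l : seq (I -> R)) (V : {set I}) (a : I -> R).
Hypothesis hs : (size l).+3 = #|V|.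
Hypothesis hl : all (@posv R I) l.
Hypothesis ha : posv a.
Hypothesis IH : forall (W : {set I}) u v, #|W| = (size l).+2 -> posv u ->
  lper [:: u, u & l] W * lper [:: v, v & l] W <= lper [:: u, v & l] W ^+ 2.

Let J := 'I_#|V|.
Let e (i : J) : I := enum_val i.
(** The Gram matrix of (x, y) -> [lper [:: x, y, a & l] V] in the coordinates of V, as [formE]
    shows. Its diagonal is 0 because two positions never share an element of V. *)
Let M (i j : J) : R := if i == j then 0 else lper (a :: l) (V :\ e i :\ e j).

Let eV i : e i \in V. Proof. exact: enum_valP. Qed.

Let sumV (F : I -> R) : \sum_(i in V) F i = \sum_(i : J) F (e i).
Proof. exact: big_enum_val. Qed.

Let eE i j : (e j == e i) = (i == j).
Proof. by rewrite eq_sym (inj_eq enum_val_inj). Qed.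

Let appE x i : \sum_j M i j * x (e j) = lper [:: x, a & l] (V :\ e i).
Proof.
rewrite lper_cons.
pose f k := if k == e i then 0 else x k * lper (a :: l) (V :\ e i :\ k).
have -> : \sum_j M i j * x (e j) = \sum_(k in V) f k.
  rewrite sumV; apply: eq_bigr => j _; rewrite /M /f eE.
  by case: eqP => _; rewrite ?mul0r // mulrC.
rewrite (big_setD1 (e i)) //= /f eqxx add0r.
by apply: eq_bigr => k; rewrite !inE => /andP[/negPf-> _].
Qed.

Let formE x y :
  \sum_i x (e i) * \sum_j M i j * y (e j) = lper [:: x, y, a & l] V.
Proof. by rewrite lper_cons sumV; apply: eq_bigr => i _; rewrite appE. Qed.

(** Extension by zero outside V, turning a coordinate vector into an argument of [lper]. *)
Let ext (x : J -> R) (k : I) : R := \sum_i (e i == k)%:R * x i.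

Let extE (x : J -> R) i : ext x (e i) = x i.
Proof.
rewrite /ext (bigD1 i) //= eqxx mul1r big1 ?addr0 // => j nji.
by rewrite eE eq_sym (negPf nji) mul0r.
Qed.

Let ext_app (x : J -> R) i : \sum_j M i j * x j = \sum_j M i j * ext x (e j).
Proof. by apply: eq_bigr => j _; rewrite extE. Qed.

Let cardD i : #|V :\ e i| = (size l).+2.
Proof. by have := cardsD1 (e i) V; rewrite eV -hs => -[]. Qed.

Lemma lper_AF_step u v : posv u ->
  lper [:: u, u, a & l] V * lper [:: v, v, a & l] V <= lper [:: u, v, a & l] V ^+ 2.
Proof.
have ae i : 0 < a (e i) by move/posvP: ha.
apply: (@lper_AF_cone _ _ a) => //=; rewrite ?ha //.
move=> z; rewrite -!formE => hz.
apply: (@lorentz_form_le0 _ _ M (fun i => a (e i))) => //.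
- by move=> i j; rewrite /M eq_sym setD1C.
- move=> i j; rewrite /M; case: eqP => // nij; apply/ltW/lper_gt0 => /=.
    by rewrite ha.
  have := cardsD1 (e j) (V :\ e i); rewrite !inE eV eE (introF eqP nij) cardD.
  by rewrite add1n => -[<-].
- move=> i j nij; rewrite /M (negPf nij); apply/lper_gt0 => /=; first by rewrite ha.
  have := cardsD1 (e j) (V :\ e i); rewrite !inE eV eE nij cardD.
  by rewrite add1n => -[<-].
- by move=> i; rewrite appE; apply: lper_gt0; rewrite /= ?ha ?cardD.
(* The form at x is expanded along a. On each V :\ e i the induction hypothesis, with a as the
   positive vector, bounds the summand by a_i (M x)_i^2 / (M a)_i. *)
- move=> x.
  have -> : \sum_i x i * \sum_j M i j * x j = lper [:: ext x, ext x, a & l] V.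
    by rewrite -formE; apply: eq_bigr => i _; rewrite extE ext_app.
  have -> : lper [:: ext x, ext x, a & l] V = lper [:: a, ext x, ext x & l] V.
    by have := lper_move [:: ext x; ext x] a l V.
  rewrite lper_cons sumV; apply: ler_sum => i _.
  rewrite ext_app !appE -mulrA ler_pM2l // ler_pdivlMr; last first.
    by apply: lper_gt0; rewrite /= ?ha ?cardD.
  by rewrite mulrC (lper_swap (ext x) a); apply: IH => //; rewrite cardD.
- rewrite -[RHS]hz; under eq_bigr do rewrite mulrC.
  rewrite -[LHS]/(\sum_i z (e i) * \sum_j M i j * a (e j)).
  by rewrite formE lper_swap -formE.
Qed.
End Step.

Theorem lper_alexandrov_fenchel l V u v :
    (size l).+2 = #|V| -> all (@posv R I) l -> posv u ->
  lper [:: u, u & l] V * lper [:: v, v & l] V <= lper [:: u, v & l] V ^+ 2.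
Proof.
elim: l V u v => [|a l IH] V u v /= hs; first by move=> _ _; exact: lper_AF2.
move=> /andP[ha hl]; apply: (lper_AF_step hs hl ha) => W u' v' hW hu'.
by apply: IH.
Qed.

End AlexandrovFenchel.

Local Close Scope ring_scope.

(** * Enumeration of partial Latin squares *)

Section Fillings.
Variables (J K : finType).
Implicit Types (F : seq J) (A : J -> {set K}) (V : {set K}).
Implicit Types (y : seq (J * K)) (t : seq (seq (J * K))) (Fs : seq {set J}).

(** Systems of distinct representatives of the sets [A j], j in F, with values in V. Words follow
    the order of F, so each system is listed once and their number is the permanent of a 0/1
    matrix. *)
Fixpoint fillings F A V : seq (seq (J * K)) :=
  if F is j :: F' then
    [seq (j, k) :: y | k <- enum (A j :&: V), y <- fillings F' A (V :\ k)]
  else [:: [::]].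

Lemma size_fillings (R : comNzRingType) F A V :
  (size (fillings F A V))%:R%R = lper [seq ind R (A j) | j <- F] V.
Proof.
elim: F V => [|j F IH] V //=.
rewrite size_allpairs_dep sumnE big_map big_enum /= natr_sum lper_cons.
under eq_bigr do rewrite IH.
rewrite [RHS](big_setID (A j)) /= setIC [X in _ = (_ + X)%R]big1 ?addr0.
  by apply: eq_bigr => k; rewrite /ind inE => /andP[_ ->]; rewrite mul1r.
by move=> k; rewrite inE /ind => /andP[/negPf-> _]; rewrite mul0r.
Qed.

Lemma mem_fillings F A V y : (y \in fillings F A V) =
  [&& unzip1 y == F, uniq (unzip2 y), all (fun jk => jk.2 \in A jk.1) y
    & all (mem V) (unzip2 y)].
Proof.
elim: F V y => [|j F IH] V [|[i k] y] //=.
  by apply/allpairsPdep => -[? [? []]].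
apply/allpairsPdep/idP => [[k' [y' [hk hy [-> -> ->]]]] | ].
  move: hk hy; rewrite mem_enum inE IH => /andP[-> ->] /and4P[/eqP-> -> -> /allP h].
  rewrite eqxx /= andbT; apply/andP; split.
    by apply/negP => /h; rewrite !inE eqxx.
  by apply/allP => x /h; rewrite !inE => /andP[].
rewrite eqseq_cons => /and4P[/andP[/eqP-> /eqP hF] /andP[hk hu] /andP[hA hAy] /andP[hV hVy]].
exists k, y; rewrite mem_enum inE hA hV IH hF eqxx hu hAy; split => //=.
apply/allP => x hx; rewrite /= !inE; have -> : x \in V by exact: (allP hVy).
rewrite andbT.
by apply: contraNneq hk => <-.
Qed.

Lemma uniq_fillings F A V : uniq (fillings F A V).
Proof.
elim: F V => //= j F IH V; apply: allpairs_uniq_dep; rewrite ?enum_uniq // => [[k y] [k' y']] _ _ /=.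
by case=> -> ->.
Qed.

Definition used t (j : J) : {set K} := [set k | has (fun y => (j, k) \in y) t].

(* A partial Latin square whose filled columns, row by row, are Fs is encoded as
   the list of its rows, and a row as the list of its (column, symbol) pairs.
   The rows are entered from the last one of Fs to the first. *)
Fixpoint pls_words Fs : seq (seq (seq (J * K))) :=
  if Fs is F :: Fs' then
    [seq y :: t | t <- pls_words Fs', y <- fillings (enum F) (fun j => ~: used t j) setT]
  else [:: [::]].

Lemma uniq_pls_words Fs : uniq (pls_words Fs).
Proof.
elim: Fs => //= F Fs IH; apply: allpairs_uniq_dep => //.
  by move=> t _; exact: uniq_fillings.
by move=> [t y] [t' y'] _ _ /= [-> ->].
Qed.

Lemma mem_pls_words_cons (F : {set J}) Fs y t : (y :: t \in pls_words (F :: Fs)) =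
  [&& t \in pls_words Fs, unzip1 y == enum F, uniq (unzip2 y)
    & all (fun jk => jk.2 \notin used t jk.1) y].
Proof.
apply/allpairsPdep/idP => [[t' [y' [ht hy [-> ->]]]] | /and4P[ht hF hu hA]].
  move: hy; rewrite ht mem_fillings => /and4P[-> -> h _]; rewrite !andTb.
  by apply: sub_all h => jk; rewrite inE.
exists t, y; split=> //; rewrite mem_fillings hF hu.
rewrite !andTb; apply/andP; split; last by apply/allP => x _; apply: in_setT.
by apply: sub_all hA => jk /= h; rewrite in_setC.
Qed.

Lemma size_mem_pls_words Fs t : t \in pls_words Fs -> size t = size Fs.
Proof.
elim: Fs t => [|F Fs IH] [|y t] //=; first by move/allpairsPdep => [? [? []]].
by rewrite -/(pls_words (F :: Fs)) mem_pls_words_cons => /and4P[/IH-> _ _ _].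
Qed.

Lemma row_functional (F : {set J}) y j : unzip1 y = enum F -> j \in F ->
  exists k, forall k', ((j, k') \in y) = (k' == k).
Proof.
move=> hy jF; have : j \in unzip1 y by rewrite hy mem_enum.
case/mapP => -[i k] hk /= ji; subst i; exists k => k'.
apply/idP/eqP => [hk'|->//].
have hu : uniq (unzip1 y) by rewrite hy enum_uniq.
elim: y hu hk hk' {hy} => //= -[i l] y IH /= /andP[hi hu].
rewrite !inE !xpair_eqE.
case: eqP => [ji|_] /=; last exact: IH.
have nj l' : (j, l') \in y = false.
  by apply: contraNF hi => h; rewrite -ji; apply/mapP; exists (j, l').
by rewrite !nj !orbF => /eqP-> /eqP->.
Qed.

Lemma used_cons y t j : used (y :: t) j = [set k | (j, k) \in y] :|: used t j.
Proof. by apply/setP => k; rewrite !inE. Qed.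

(** Each row that fills column j adds one symbol to it, and a new one since the row avoids
    [used t j]. *)
Lemma card_used Fs t j : t \in pls_words Fs ->
  #|used t j| = count (fun F : {set J} => j \in F) Fs.
Proof.
elim: Fs t => [|F Fs IH] [|y t] //=.
- by move=> _; apply: eq_card0 => k; rewrite !inE.
- by move/allpairsPdep => [? [? []]].
rewrite -/(pls_words (F :: Fs)) mem_pls_words_cons => /and4P[ht /eqP hF hu hA].
rewrite used_cons -(IH t ht); case: (boolP (j \in F)) => jF.
  have [k hk] := row_functional hF jF.
  have -> : [set k' | (j, k') \in y] = [set k] by apply/setP => k'; rewrite !inE hk.
  rewrite cardsU1 (_ : k \notin used t j) //.
  by apply: (allP hA (j, k)); rewrite hk.
rewrite (_ : [set _ | _] = set0) ?set0U //.
apply/setP => k; rewrite !inE; apply: contraNF jF => h.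
by rewrite -mem_enum -hF; apply/mapP; exists (j, k).
Qed.

Lemma size_pls_words_cons (F : {set J}) Fs : size (pls_words (F :: Fs)) =
  \sum_(t <- pls_words Fs) size (fillings (enum F) (fun j => ~: used t j) setT).
Proof. by rewrite size_allpairs_dep sumnE big_map. Qed.

End Fillings.

(** * Latin squares and teaching sets *)

(** The alternative N <= k covers the case where the default value attains the minimum. *)
Lemma bigmin_witness (J : finType) (P : pred J) (f : J -> nat) N k :
  \big[minn/N]_(i | P i) f i <= k -> N <= k \/ exists2 i, P i & f i <= k.
Proof.
elim/big_ind: _ => [|x y hx hy|i Pi]; first by left.
  by rewrite geq_min => /orP[/hx|/hy].
by right; exists i.
Qed.

Lemma exists_subset_card (T : finType) (A B : {set T}) k :
    A \subset B -> #|A| <= k <= #|B| ->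
  exists2 S : {set T}, (A \subset S) && (S \subset B) & #|S| = k.
Proof.
move=> sAB; elim: k => [|k IH] /andP[hA hB].
  have A0 : #|A| = 0 by apply/eqP; rewrite -leqn0.
  by exists A; rewrite ?subxx.
move: hA; rewrite leq_eqVlt => /predU1P[hA|hA]; first by exists A; rewrite ?subxx.
have [|S /andP[AS SB] hS] := IH; first by rewrite -ltnS hA ltnW.
have /card_gt0P[x] : 0 < #|B :\: S|.
  by have := cardsID S B; rewrite (setIidPr SB) hS; lia.
rewrite inE => /andP[xS xB]; exists (x |: S); last by rewrite cardsU1 xS hS.
by rewrite subUset sub1set xB SB (subset_trans AS (subsetUr _ _)).
Qed.

Section Latin.
Variable n : nat.
Local Notation cell := ('I_n * 'I_n)%type.
Local Notation triple := ('I_n * 'I_n * 'I_n)%type.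
Implicit Types (L : 'M['I_n]_n) (E : {set cell}) (t : seq (seq cell)).

Lemma card_fiber1 (f : 'I_n -> 'I_n) :
  (forall k, #|[set j | f j == k]| = 1) <-> injective f.
Proof.
split=> [h j j' e | inj k].
  have /eqP/cards1P[x hx] := h (f j).
  have : j \in [set j0 | f j0 == f j] by rewrite inE.
  have : j' \in [set j0 | f j0 == f j] by rewrite inE e.
  by rewrite hx !inE => /eqP-> /eqP->.
have [g fK gK] := injF_bij inj.
have -> : [set j | f j == k] = [set g k].
  by apply/setP => j; rewrite !inE; apply/eqP/eqP => [<-|->]; rewrite ?fK ?gK.
exact: cards1.
Qed.

Lemma is_latinP L : reflect
  ((forall i, injective (L i)) /\ (forall j, injective (L^~ j))) (is_latin L).
Proof.
apply: (iffP andP) => [[/'forall_forallP hr /'forall_forallP hc]|[hr hc]].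
  split=> [i|j]; apply/card_fiber1 => k; apply/eqP; [exact: hr | exact: hc].
split; apply/'forall_forallP => i k; apply/eqP; move: k; apply/card_fiber1;
  [exact: hr | exact: hc].
Qed.

Lemma mem_cells L i j k : ((i, j, k) \in cells L) = (L i j == k).
Proof. by rewrite inE. Qed.

Lemma card_cells L : #|cells L| = n ^ 2.
Proof.
have -> : cells L = [set (x, L x.1 x.2) | x in [set: cell]].
  apply/setP => -[[i j] k]; rewrite mem_cells; apply/eqP/imsetP => [<-|[[i' j'] _ [-> -> ->]] //].
  by exists (i, j).
by rewrite card_imset ?cardsT ?card_prod ?card_ord ?mulnn // => x y [].
Qed.

Definition row_cells E (i : 'I_n) : {set 'I_n} := [set j | (i, j) \in E].

Definition row_word L E (i : 'I_n) : seq cell :=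
  [seq (j, L i j) | j <- enum (row_cells E i)].

Definition decode t : {set triple} :=
  [set x : triple | (x.1.2, x.2) \in nth [::] t x.1.1].

Lemma mem_row_word L E i j k :
  ((j, k) \in row_word L E i) = ((i, j) \in E) && (L i j == k).
Proof.
apply/mapP/andP => [[j' + [-> ->]] | [hE /eqP<-]]; first by rewrite mem_enum inE.
by exists j => //; rewrite mem_enum inE.
Qed.

Lemma row_words_pls_words L E (s : seq 'I_n) : is_latin L -> uniq s ->
  map (row_word L E) s \in pls_words 'I_n (map (row_cells E) s).
Proof.
move=> /is_latinP[hr hc]; elim: s => [|i s IH]; first by rewrite inE.
rewrite cons_uniq => /andP[hi hs]; rewrite map_cons [map (row_cells E) _]map_cons.
rewrite mem_pls_words_cons IH //=; apply/and3P; split.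
- by rewrite /unzip1 -map_comp map_id_in.
- by rewrite /unzip2 -map_comp map_inj_uniq ?enum_uniq // => x y; exact: hr.
apply/allP => -[j k]; rewrite mem_row_word => /andP[_ /eqP hk] /=.
rewrite inE; apply/hasPn => _ /mapP[i' hi' ->]; rewrite mem_row_word negb_and.
apply/orP; right; apply: contra hi => /eqP e.
by rewrite (hc j i i') // hk e.
Qed.

Lemma decode_row_words L E :
  decode (map (row_word L E) (enum 'I_n)) = cells L :&: [set x : triple | x.1 \in E].
Proof.
apply/setP => -[[i j] k]; rewrite !inE /=.
by rewrite (nth_map i) ?size_enum_ord // nth_ord_enum mem_row_word andbC.
Qed.

Lemma nth_pls_words (Fs : seq {set 'I_n}) t i : t \in pls_words 'I_n Fs -> i < size Fs ->
  unzip1 (nth [::] t i) = enum (nth set0 Fs i) /\ uniq (unzip2 (nth [::] t i)).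
Proof.
elim: Fs t i => [|F Fs IH] [|y t] i //; first by move/size_mem_pls_words.
rewrite mem_pls_words_cons => /and4P[ht /eqP hy hu _].
by case: i => [|i] //= hi; exact: IH.
Qed.

(** The row at the smaller position i is entered after the one at i', hence avoids the symbols
    already placed in each column. *)
Lemma nth_pls_words_disjoint (Fs : seq {set 'I_n}) t i i' j k : t \in pls_words 'I_n Fs ->
  i < i' -> (j, k) \in nth [::] t i -> (j, k) \notin nth [::] t i'.
Proof.
elim: Fs t i i' => [|F Fs IH] t i i' ht.
  by rewrite (size0nil (size_mem_pls_words ht)) nth_nil.
case: t ht => [/size_mem_pls_words //|y t]; case: i' => [//|i'].
rewrite mem_pls_words_cons => /and4P[ht _ _ /allP hA].
case: i => [|i] /= hi; last exact: IH.
move=> /hA /=; rewrite inE => /hasPn h.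
have [hs|hs] := ltnP i' (size t); first by apply: h; rewrite mem_nth.
by rewrite nth_default.
Qed.

Lemma full_pls_words_latin t : t \in pls_words 'I_n (nseq n [set: 'I_n]) ->
  exists2 L, is_latin L & t = map (row_word L [set: cell]) (enum 'I_n).
Proof.
move=> ht; pose y (i : 'I_n) := nth [::] t i.
have hy (i : 'I_n) : unzip1 (y i) = enum [set: 'I_n] /\ uniq (unzip2 (y i)).
  by have := nth_pls_words ht (i := i); rewrite size_nseq nth_nseq ltn_ord; apply.
(* The default [j] is never reached: by [hy] each row word is a function defined on all columns. *)
pose L : 'M['I_n]_n := (\matrix_(i, j) odflt j [pick k | (j, k) \in y i])%R.
have hL i j k : ((j, k) \in y i) = (L i j == k).
  have [k0 hk] := row_functional (proj1 (hy i)) (in_setT j).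
  rewrite mxE; case: pickP => [k1|/(_ k0)] /=; last by rewrite hk eqxx.
  by rewrite !hk => /eqP->; rewrite eq_sym.
have hw (i : 'I_n) : y i = row_word L [set: cell] i.
  have e : y i = [seq (j, L i j) | j <- unzip1 (y i)].
    rewrite -map_comp map_id_in // => -[j k] /=; by rewrite hL => /eqP->.
  rewrite e (proj1 (hy i)) /row_word; congr [seq _ | _ <- _].
  by apply: eq_enum => j; rewrite !inE.
exists L.
  apply/is_latinP; split=> [i j j' e|j i i' e].
    have /dinjectiveP h : uniq [seq L i x | x <- enum [set: 'I_n]].
      have := proj2 (hy i); rewrite hw /unzip2 -map_comp.
      rewrite (_ : enum (row_cells _ _) = enum [set: 'I_n]) //.
      by apply: eq_enum => x; rewrite !inE.
    by apply: h; rewrite ?in_setT.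
  apply: val_inj; have hk := hL i j (L i j); rewrite eqxx in hk.
  have hk' := hL i' j (L i j); rewrite e eqxx in hk'.
  rewrite -e in hk'; case: (ltngtP i i') => // hii.
    by have := nth_pls_words_disjoint ht hii hk; rewrite hk'.
  by have := nth_pls_words_disjoint ht hii hk'; rewrite hk.
apply: (@eq_from_nth _ [::]).
  by rewrite (size_mem_pls_words ht) size_nseq size_map size_enum_ord.
move=> i; rewrite (size_mem_pls_words ht) size_nseq => hi.
pose i' := Ordinal hi.
by rewrite (nth_map i') ?size_enum_ord // (nth_ord_enum i' i') -hw.
Qed.

Lemma card_latin_ge : size (pls_words 'I_n (nseq n [set: 'I_n])) <= #|latin_squares n|.
Proof.
rewrite -(size_map decode); rewrite cardE; apply: uniq_leq_size.
  rewrite map_inj_in_uniq ?uniq_pls_words // => t t' /full_pls_words_latin[L hL ->].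
  move=> /full_pls_words_latin[L' hL' ->]; rewrite !decode_row_words.
  move=> /setP e; apply: eq_map => i; rewrite /row_word; apply: eq_map => j.
  by have := e (i, j, L i j); rewrite !inE /= eqxx !andbT => /esym/eqP->.
move=> _ /mapP[t /full_pls_words_latin[L hL ->] ->]; rewrite mem_enum decode_row_words.
rewrite (_ : cells L :&: _ = cells L) ?imset_f ?inE //.
by apply/setP => x; rewrite !inE andbT.
Qed.

(** * Completable partial squares and teaching sets *)

Definition partial_squares (C : {set {set triple}}) k : {set {set triple}} :=
  [set T : {set triple} | (#|T| == k) && [exists c in C, T \subset c]].

Lemma cells_restrict L (T : {set triple}) : T \subset cells L ->
  T = cells L :&: [set x : triple | x.1 \in [set y.1 | y in T]].
Proof.
move=> /subsetP sT; apply/setP => -[[i j] k]; rewrite in_setI mem_cells [in RHS]in_set /=.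
apply/idP/andP => [h|[/eqP<- /imsetP[[[i' j'] k'] hT [-> ->]]]].
  by split; [rewrite -mem_cells sT | apply/imsetP; exists (i, j, k)].
by have := sT _ hT; rewrite mem_cells => /eqP->.
Qed.

(** The partial squares are sorted by their set E of filled cells. Those with given E are the
    decodings of the row words of their completions restricted to E. *)
Lemma card_partial_squares k : #|partial_squares (latin_squares n) k| <=
  \sum_(E : {set cell} | #|E| == k) size (pls_words 'I_n (map (row_cells E) (enum 'I_n))).
Proof.
rewrite -sum1_card (partition_big (fun T : {set triple} => [set y.1 | y in T])
  (fun E => #|E| == k)) /=.
  apply: leq_sum => E _; rewrite sum1_card -(size_map decode).
  apply: leq_trans (card_size _); apply: subset_leq_card; apply/subsetP => T.
  move=> /andP[+ /eqP hE]; rewrite inE => /andP[_ /exists_inP[_ /imsetP[L hL ->] sT]].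
  rewrite (cells_restrict sT) hE -decode_row_words; apply: map_f.
  by apply: row_words_pls_words; rewrite ?enum_uniq // inE in hL *.
move=> T; rewrite inE => /andP[/eqP hT /exists_inP[_ /imsetP[L _ ->] sT]].
rewrite card_in_imset ?hT // => -[[i j] k1] [[i' j'] k2] /(subsetP sT) + /(subsetP sT).
by rewrite !mem_cells => /eqP<- /eqP<- /= [-> ->].
Qed.

Lemma TDmin_witness (C : {set {set triple}}) k : TDmin C <= k -> C != set0 ->
  exists c S, [/\ c \in C, teaching_set C c S & #|S| <= k].
Proof.
move=> h /set0Pn[c0 c0C].
(* This handles the default values of both minima: the whole domain is a teaching set. *)
have top : #|{: triple}| <= k -> exists c S, [/\ c \in C, teaching_set C c S & #|S| <= k].
  by move=> hk; exists c0, setT; rewrite c0C teaching_setT cardsT.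
case: (bigmin_witness h) => // -[c cC] /bigmin_witness[] // [S hS hk].
by exists c, S.
Qed.

Lemma positive_teaching_set (C : {set {set triple}}) c S : C \subset latin_squares n ->
    c \in C -> teaching_set C c S ->
  exists T : {set triple}, [/\ T \subset c, #|T| <= #|S| &
    forall c', c' \in C -> T \subset c' -> c' = c].
Proof.
move=> /subsetP hC cC /forall_inP hS.
have /imsetP[L _ cE] := hC c cC.
(* Each example is replaced by the positive example of c in the same cell; a Latin square containing
   the latter agrees with c on every triple of that cell. *)
pose f (x : triple) : triple := (x.1, L x.1.1 x.1.2).
exists (f @: S); split; last 1 first.
- move=> c' c'C /subsetP hT; apply/eqP; have := hS c' c'C; apply: contraTT => ne.
  rewrite ne /= negbK; apply/eqP/setP => -[[i j] k]; rewrite !inE.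
  have /imsetP[L' _ c'E] := hC c' c'C.
  case: (boolP ((i, j, k) \in S)) => hx; last by rewrite !andbF.
  have := hT (f (i, j, k)) (imset_f f hx); rewrite !andbT cE c'E /f /= !mem_cells.
  by move=> /eqP->.
- by apply/subsetP => _ /imsetP[x _ ->]; rewrite cE /f in_set.
- exact: leq_imset_card.
Qed.

(* Peel off one square at a time: the teaching set of the removed square c,
   enlarged to k cells of c, lies in no remaining square. *)
Lemma card_le_partial_squares (C : {set {set triple}}) k :
    RTD (latin_squares n) <= k <= n ^ 2 -> C \subset latin_squares n ->
  #|C| <= #|partial_squares C k|.
Proof.
move=> /andP[hk kn]; move: {2}#|C| (erefl #|C|) => m.
elim: m C => [|m IH] C hm sC; first by rewrite hm.
have C0 : C != set0 by rewrite -card_gt0 hm.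
have hTD : TDmin C <= k by apply: leq_trans hk; apply: (leq_bigmax_cond (F := @TDmin _)); rewrite sC.
have [c [S [cC hS cardS]]] := TDmin_witness hTD C0.
have [T0 [T0c cT0 uT0]] := positive_teaching_set sC cC hS.
have cc : #|c| = n ^ 2 by have /imsetP[L _ ->] := subsetP sC _ cC; exact: card_cells.
have [|T /andP[T0T Tc] cT] := @exists_subset_card _ T0 c k T0c.
  by rewrite (leq_trans cT0 cardS) cc.
have hD : #|C :\ c| = m by move: hm; rewrite (cardsD1 c) cC => -[].
have := IH (C :\ c) hD (subset_trans (subsetDl _ _) sC).
rewrite hD hm => h; apply: leq_ltn_trans h _; apply: proper_card.
apply/properP; split.
  apply/subsetP => U; rewrite !inE => /andP[-> /exists_inP[c' + sU]].
  by rewrite !inE => /andP[_ c'C]; apply/exists_inP; exists c'.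
exists T; first by rewrite inE cT eqxx; apply/exists_inP; exists c.
rewrite inE negb_and; apply/orP; right; apply/exists_inPn => c'.
rewrite !inE => /andP[ne c'C]; apply: contra ne => sT.
by apply/eqP/uT0 => //; apply: subset_trans sT.
Qed.

End Latin.

From mathcomp Require Import all_classical all_reals all_analysis.
Import Order.TTheory GRing.Theory Num.Theory.
Import numFieldNormedType.Exports.
Local Open Scope ring_scope.

(** * The permanent of a doubly stochastic matrix is at least e^-n *)

Lemma ln_le_sub1 (R : realType) (x : R) : 0 < x -> ln x <= x - 1.
Proof. by move=> x0; rewrite -{1}(subrKC 1 x) le_ln1Dx // ltrBrDl subrr. Qed.

Lemma ln_prod (R : realType) (J : Type) (s : seq J) (P : pred J) (F : J -> R) :
    (forall i, P i -> 0 < F i) ->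
  ln (\prod_(i <- s | P i) F i) = \sum_(i <- s | P i) ln (F i).
Proof.
move=> hF; elim: s => [|i s IH]; first by rewrite !big_nil ln1.
rewrite !big_cons; case: ifP => // Pi.
by rewrite lnM ?IH // posrE ?hF // prodr_gt0.
Qed.

(** Average the tangent bound ln (x_j / S) <= x_j / S - 1 with the weights p. *)
Lemma weighted_AMGM_ln (R : realType) (J : finType) (p x : J -> R) :
    (forall j, 0 <= p j) -> \sum_j p j = 1 -> (forall j, 0 < x j) ->
  \sum_j p j * ln (x j) <= ln (\sum_j p j * x j).
Proof.
move=> p0 p1 x0; set S := \sum_j p j * x j.
have S0 : 0 < S.
  rewrite lt_neqAle sumr_ge0 ?andbT; last by move=> j _; rewrite mulr_ge0 // ltW.
  apply/eqP => /esym/eqP; rewrite psumr_eq0 => [/allP h|j _]; last by rewrite mulr_ge0 // ltW.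
  suff : \sum_j p j = 0 by rewrite p1 => /eqP; rewrite oner_eq0.
  apply: big1 => j _; have := h j (mem_index_enum _) => /=.
  by rewrite mulf_eq0 (gt_eqF (x0 j)) orbF => /eqP.
have h j : p j * ln (x j) <= p j * (ln S - 1) + p j * x j / S.
  rewrite -mulrA -mulrDr ler_wpM2l //.
  have := ln_le_sub1 (divr_gt0 (x0 j) S0).
  by rewrite ln_div ?posrE // lerBlDr => /le_trans; apply; lra.
apply: le_trans (ler_sum _ (fun j _ => h j)) _.
by rewrite big_split /= -!mulr_suml p1 -/S divff ?gt_eqF //; lra.
Qed.

(** * Growth of permanents along a line, from log-concavity *)

Section Capacity.
Variables (R : realType) (I : finType).
Implicit Types (u v : I -> R) (l : seq (I -> R)) (V : {set I}).

Lemma lper_pos V l : all (@posv R I) l -> (size l <= #|V|)%N -> 0 < lper l V.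
Proof. exact: lper_gt0. Qed.

Lemma all_posv_nseq k u : posv u -> all (@posv R I) (nseq k u).
Proof. by move=> hu; rewrite all_nseq hu orbT. Qed.

Let add u (t : R) v : I -> R := fun i => u i + t * v i.

Let posv_add u t v : posv u -> posv v -> 0 <= t -> posv (add u t v).
Proof.
move=> /posvP hu /posvP hv ht; apply/posvP => i.
by rewrite /add ltr_pwDl // mulr_ge0 // ltW.
Qed.

(** With w = u + t v, the ratio of the permanents starting with v and with u does not increase when
    a further u is replaced by w: by linearity this is Alexandrov-Fenchel for u and v. Induction on
    N chains these comparisons. *)
Lemma lper_ratio V l u v t N M : posv u -> posv v -> 0 <= t ->
    all (@posv R I) l -> (N + M + (size l).+1)%N = #|V| ->
  lper (v :: nseq N (add u t v) ++ nseq M u ++ l) V * lper (nseq (N + M).+1 u ++ l) V <=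
  lper (u :: nseq N (add u t v) ++ nseq M u ++ l) V * lper (v :: nseq (N + M) u ++ l) V.
Proof.
move=> hu hv ht hl hV; set w := add u t v; have hw : posv w by exact: posv_add.
elim: N M hV => [|N IH] M hV; first by rewrite mulrC.
set r := nseq N w ++ nseq M u ++ l.
have hr : all (@posv R I) r by rewrite !all_cat !all_posv_nseq.
have hs : (size r).+2 = #|V|.
  by rewrite -hV /r !size_cat !size_nseq; lia.
have AF : lper [:: v, w & r] V * lper [:: u, u & r] V <=
          lper [:: u, w & r] V * lper [:: v, u & r] V.
  rewrite (lper_swap v w) (lper_swap u w) !lper_lin (lper_swap v u).
  have := lper_alexandrov_fenchel v hs hr hu.
  nra.
have gt0 x y : posv x -> posv y -> 0 < lper [:: x, y & r] V.
  by move=> hx hy; apply: lper_pos; rewrite /= ?hx ?hy // hs.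
have := IH M.+1; rewrite -(addSnnS N M) => /(_ hV).
have mv x : lper (x :: nseq N w ++ nseq M.+1 u ++ l) V = lper [:: x, u & r] V.
  by rewrite !lper_cons; apply: eq_bigr => i _; rewrite lper_move.
rewrite !mv => {}IH.
set P := lper (nseq _ u ++ l) V in IH *; set Q := lper (v :: nseq _ u ++ l) V in IH *.
have P0 : 0 < P.
  apply: lper_pos; first by rewrite all_cat all_posv_nseq.
  by rewrite size_cat size_nseq; lia.
have uu0 := gt0 _ _ hu hu.
rewrite -(ler_pM2r uu0) mulrAC.
apply: le_trans (ler_wpM2r (ltW P0) AF) _.
rewrite -!mulrA (mulrC Q); apply: ler_wpM2l; last exact: IH.
exact/ltW/gt0.
Qed.

(** Replacing the copies of u by w one at a time multiplies the permanent by at most 1 + t q / p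
    each time, by [lper_ratio]. The bound has the same value and derivative at t = 0 as the
    left-hand side. *)
Lemma lper_growth V l u v t K : posv u -> posv v -> 0 <= t ->
    all (@posv R I) l -> (K.+1 + size l)%N = #|V| ->
  lper (nseq K.+1 (add u t v) ++ l) V <= lper (nseq K.+1 u ++ l) V *
    (1 + t * (lper (v :: nseq K u ++ l) V / lper (nseq K.+1 u ++ l) V)) ^+ K.+1.
Proof.
move=> hu hv ht hl hV; set w := add u t v; have hw : posv w by exact: posv_add.
set p := lper (nseq K.+1 u ++ l) V; set q := lper (v :: nseq K u ++ l) V.
have p0 : 0 < p.
  by apply: lper_pos; rewrite ?all_cat ?all_posv_nseq // size_cat size_nseq hV.
have q0 : 0 < q.
  apply: lper_pos; first by rewrite /= hv all_cat all_posv_nseq.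
  by rewrite /= size_cat size_nseq -hV.
suff H N M : (N + M = K.+1)%N ->
    lper (nseq N w ++ nseq M u ++ l) V <= p * (1 + t * (q / p)) ^+ N.
  by have := H K.+1 0%N (addn0 _); rewrite cat0s.
elim: N M => [|N IH] M hNM; first by rewrite add0n in hNM; rewrite hNM mulr1.
have hr : forall x, posv x -> 0 < lper (x :: nseq N w ++ nseq M u ++ l) V.
  move=> x hx; apply: lper_pos; first by rewrite /= hx !all_cat !all_posv_nseq.
  by rewrite /= !size_cat !size_nseq; lia.
have := IH M.+1; rewrite addnS -addSn => /(_ hNM).
rewrite [nseq M.+1 u ++ l]/= lper_move => {}IH.
have hK : (N + M = K)%N by lia.
have := @lper_ratio V l u v t N M hu hv ht hl; rewrite hK => /(_ ltac:(lia)) /=.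
rewrite -/p -/q -/w => hq.
rewrite lper_lin exprSr mulrA.
set X := lper (v :: _) V in hq *; set Y := lper (u :: _) V in hq IH *.
apply: (@le_trans _ _ (Y * (1 + t * (q / p)))); last first.
  apply: ler_wpM2r; last exact: IH.
  by rewrite addr_ge0 // mulr_ge0 // divr_ge0 // ltW.
rewrite mulrDr mulr1 lerD2l mulrCA; apply: ler_wpM2l => //.
by rewrite mulrA ler_pdivlMr.
Qed.

End Capacity.

Section DoublyStochastic.
Variables (R : realType) (I : finType).
Implicit Types (u v : I -> R) (l : seq (I -> R)) (V : {set I}).

Lemma lper_derivative_ge V l u v K (B : R) : posv u -> posv v ->
    all (@posv R I) l -> (K.+1 + size l)%N = #|V| ->
    (forall t, 0 < t -> t * B <= lper (nseq K.+1 (fun i => u i + t * v i) ++ l) V) ->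
  B <= expR 1 * K.+1%:R * lper (v :: nseq K u ++ l) V.
Proof.
move=> hu hv hl hV hB.
have hg t (ht : 0 <= t) := lper_growth hu hv ht hl hV.
set p := lper (nseq K.+1 u ++ l) V in hg.
set q := lper (v :: nseq K u ++ l) V in hg *.
have p0 : 0 < p.
  by apply: lper_pos; rewrite ?all_cat ?all_posv_nseq // size_cat size_nseq hV.
have q0 : 0 < q.
  apply: lper_pos; first by rewrite /= hv all_cat all_posv_nseq.
  by rewrite /= size_cat size_nseq -hV.
have K0 : 0 < K.+1%:R :> R by rewrite ltr0n.
(* With this t, the growth factor is (1 + 1/(K+1))^(K+1) <= e. *)
pose t := p / (K.+1%:R * q).
have t0 : 0 < t by rewrite divr_gt0 ?mulr_gt0.
have := le_trans (hB t t0) (hg t (ltW t0)).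
have -> : t * (q / p) = K.+1%:R^-1.
  by rewrite /t; field; rewrite !gt_eqF // pnatr_eq0.
have h1 : (1 + K.+1%:R^-1) ^+ K.+1 <= expR 1 :> R.
  have -> : expR 1 = expR (K.+1%:R^-1) ^+ K.+1 :> R.
    by rewrite -expRM_natl mulfV // gt_eqF.
  by apply: lerXn2r; rewrite ?nnegrE ?expR_ge0 ?expR_ge1Dx // addr_ge0 // invr_ge0 ltW.
move=> h2; have : t * B <= p * expR 1 by apply: le_trans h2 _; rewrite ler_pM2l.
rewrite mulrC -ler_pdivlMr // => /le_trans; apply.
rewrite /t le_eqVlt; apply/orP; left; apply/eqP.
by field; rewrite !gt_eqF // pnatr_eq0.
Qed.

Section Capacity.
Variables (n : nat) (a : nat -> I -> R).
Hypothesis hn : #|I| = n.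
Hypothesis a_gt0 : forall j i, 0 < a j i.
Hypothesis cap : forall x : nat -> R, (forall j, 0 < x j) ->
  \prod_(j < n) x j <= \prod_i \sum_(j < n) x j * a j i.

Let lin k (x : nat -> R) : I -> R := fun i => \sum_(j < k) x j * a j i.

Let apos j : posv (a j). Proof. exact/posvP. Qed.

Let lin_pos k x : (forall j, 0 < x j) -> posv (lin k.+1 x).
Proof.
move=> hx; apply/posvP => i; rewrite /lin big_ord_recr /= ltr_wpDl ?mulr_gt0 //.
by apply: sumr_ge0 => j _; rewrite ltW ?mulr_gt0.
Qed.

(* Gurvits' capacity argument: after differentiating in x_{m+k-1}, ..., x_k at 0,
   one loses at most a factor e per variable. *)
Lemma lper_partial_capacity m k (x : nat -> R) : (k + m)%N = n -> (forall j, 0 < x j) ->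
  k`!%:R * expR (- m%:R) * \prod_(j < k) x j <=
  lper (nseq k (lin k x) ++ [seq a j | j <- iota k m]) [set: I].
Proof.
elim: m k x => [|m IH] k x hk hx.
  (* When k = n all variables are present: the permanent is n! times the product of the linear
     forms, and [cap] applies. *)
  rewrite addn0 in hk; rewrite cats0 (@lper_nseq R) ?cardsT ?hn ?hk //.
  rewrite oppr0 expR0 mulr1; apply: ler_wpM2l => //.
  apply: le_trans (cap hx) _; rewrite le_eqVlt; apply/orP; left; apply/eqP.
  by apply: eq_bigl => i; rewrite inE.
set l := [seq a j | j <- iota k.+1 m].
have -> : [seq a j | j <- iota k m.+1] = a k :: l by [].
have hl : all (@posv R I) l by rewrite all_map; apply/allP => j _; exact: apos.
have sl : size l = m by rewrite size_map size_iota.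
rewrite lper_move.
have key t : 0 < t -> t * (k.+1`!%:R * expR (- m%:R) * \prod_(j < k) x j) <=
    lper (nseq k.+1 (fun i => lin k x i + t * a k i) ++ l) [set: I].
  move=> t0; pose y j := if (j < k)%N then x j else t.
  have hy j : 0 < y j by rewrite /y; case: ifP.
  have := IH k.+1 y; rewrite addSnnS => /(_ hk hy).
  have -> : lin k.+1 y = (fun i => lin k x i + t * a k i).
    apply/funext => i; rewrite /lin big_ord_recr /= /y ltnn; congr (_ + _).
    by apply: eq_bigr => j _; rewrite ltn_ord.
  rewrite big_ord_recr /= {2}/y ltnn.
  have -> : \prod_(i < k) y i = \prod_(j < k) x j.
    by apply: eq_bigr => j _; rewrite /y ltn_ord.
  by move=> h; rewrite mulrC -(mulrA _ _ t).
have expS : expR (- m.+1%:R) * expR 1 = expR (- m%:R) :> R.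
  by rewrite -expRD -natr1 opprD subrK.
(* For k = 0 the vector [lin 0 x] is zero, not positive, so [lper_derivative_ge] does not apply;
   [key] at t = 1 suffices. *)
clearbody l; case: k hk key => [|k] hk key.
  have := key 1 ltr01; rewrite !mul1r !big_ord0 !mulr1.
  have -> : (fun i => lin 0 x i + 1 * a 0%N i) = a 0%N.
    by apply/funext => i; rewrite /lin big_ord0 add0r mul1r.
  apply: le_trans.
  by rewrite ler_expR lerN2 ler_nat.
have := @lper_derivative_ge [set: I] l (lin k.+1 x) (a k.+1) k.+1 _ _ _ _ _ key.
rewrite lin_pos // apos hl cardsT sl hn addSnnS => /(_ isT isT isT hk).
rewrite [k.+2`!]factS natrM -expS => h.
have e0 : 0 < expR 1 * k.+2%:R :> R by rewrite mulr_gt0 ?expR_gt0 ?ltr0n.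
rewrite -(ler_pM2l e0); apply: le_trans h.
by rewrite le_eqVlt; apply/orP; left; apply/eqP; ring.
Qed.

Lemma lper_capacity : expR (- n%:R) <= lper [seq a j | j <- iota 0 n] [set: I].
Proof.
have := @lper_partial_capacity n 0 (fun=> 1) (add0n n) (fun=> ltr01).
by rewrite fact0 mul1r big_ord0 mulr1.
Qed.

End Capacity.

(** Double stochasticity gives the capacity hypothesis: apply weighted AM-GM for each i, and sum
    over i, where the total weight of each ln (x j) is 1. *)
Lemma lper_doubly_stochastic_pos n (a : nat -> I -> R) : #|I| = n ->
    (forall j i, 0 < a j i) ->
    (forall i, \sum_(j < n) a j i = 1) -> (forall j, (j < n)%N -> \sum_i a j i = 1) ->
  expR (- n%:R) <= lper [seq a j | j <- iota 0 n] [set: I].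
Proof.
move=> hn a0 hc hr; apply: lper_capacity => // x hx.
have s0 i : 0 < \sum_(j < n) x j * a j i.
  have n0 : (0 < n)%N by rewrite -hn; apply/card_gt0P; exists i.
  rewrite (bigD1 (Ordinal n0)) //= ltr_pwDl ?mulr_gt0 //.
  by apply: sumr_ge0 => j _; rewrite ltW ?mulr_gt0.
rewrite -ler_ln ?posrE ?prodr_gt0 // !ln_prod //.
have h i : \sum_(j < n) a j i * ln (x j) <= ln (\sum_(j < n) x j * a j i).
  have := @weighted_AMGM_ln R 'I_n (fun j => a j i) (fun j => x j).
  under [in X in _ -> _ -> _ -> _ <= X]eq_bigr do rewrite mulrC.
  by apply=> // j; rewrite ltW.
apply: le_trans (ler_sum _ (fun i _ => h i)).
rewrite exchange_big /= le_eqVlt; apply/orP; left; apply/eqP.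
by apply: eq_bigr => j _; rewrite -mulr_suml hr ?mul1r.
Qed.

End DoublyStochastic.

Lemma lper_scale (R : comNzRingType) (I : finType) (c : R) (l : seq (I -> R)) (V : {set I}) :
  lper [seq (fun i => c * a i) | a <- l] V = c ^+ size l * lper l V.
Proof.
elim: l V => [|a l IH] V /=; first by rewrite !lper_nil mulr1.
rewrite !lper_cons mulr_sumr; apply: eq_bigr => i _.
by rewrite IH exprS; ring.
Qed.

Lemma lper_horner (R : comNzRingType) (I : finType) (x : R) (l : seq (I -> {poly R}))
    (V : {set I}) :
  (lper l V).[x] = lper [seq (fun i => (a i).[x]) | a <- l] V.
Proof.
elim: l V => [|a l IH] V /=; first by rewrite !lper_nil hornerC.
rewrite !lper_cons horner_sum; apply: eq_bigr => i _.
by rewrite hornerM IH.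
Qed.

Section DoublyStochastic.
Variables (R : realType) (I : finType).

(** Zero entries are reached as a limit: a + x is positive and becomes doubly stochastic after
    division by c = 1 + n x. As c^n >= 1 the bound holds for a + x, and the permanent is a
    polynomial in x, hence continuous as x -> 0+. *)
Lemma lper_doubly_stochastic n (a : nat -> I -> R) : #|I| = n ->
    (forall j i, 0 <= a j i) ->
    (forall i, \sum_(j < n) a j i = 1) -> (forall j, (j < n)%N -> \sum_i a j i = 1) ->
  expR (- n%:R) <= lper [seq a j | j <- iota 0 n] [set: I].
Proof.
move=> hn a0 hc hr.
pose p := lper [seq (fun i => (a j i)%:P + 'X) | j <- iota 0 n] [set: I].
have pE x : p.[x] = lper [seq (fun i => a j i + x) | j <- iota 0 n] [set: I].
  rewrite /p lper_horner -map_comp; congr lper; apply: eq_map => j /=.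
  by apply/funext => i; rewrite hornerD hornerC hornerX.
have -> : lper [seq a j | j <- iota 0 n] [set: I] = p.[0].
  by rewrite pE; congr lper; apply: eq_map => j; apply/funext => i; rewrite addr0.
have cv : (p.[x] @[x --> 0^'+] --> p.[0])%classic.
  exact/cvg_at_right_filter/continuous_horner.
apply: (cvgr_to_ge cv); near=> x.
have x0 : 0 < x by near: x; exact: nbhs_right_gt.
pose c := 1 + n%:R * x; have c1 : 1 <= c by rewrite /c lerDl mulr_ge0 // ltW.
have c0 : 0 < c by apply: lt_le_trans c1.
have cE : c = 1 + \sum_(j < n) x by rewrite sumr_const card_ord -mulr_natl.
pose b j i := c^-1 * (a j i + x).
have -> : p.[x] = c ^+ n * lper [seq b j | j <- iota 0 n] [set: I].
  rewrite pE -{2}(size_iota 0 n) -(size_map b) -lper_scale -map_comp.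
  congr lper; apply: eq_map => j /=; apply/funext => i.
  by rewrite /b mulrA mulfV ?mul1r // gt_eqF.
apply: le_trans (_ : lper [seq b j | j <- iota 0 n] [set: I] <= _).
  apply: lper_doubly_stochastic_pos => //.
  - by move=> j i; rewrite mulr_gt0 ?invr_gt0 // ltr_wpDl.
  - move=> i; rewrite -mulr_sumr big_split /= hc -cE mulVf // gt_eqF //.
  - move=> j jn; rewrite -mulr_sumr big_split /= hr // sumr_const cardT -cardE hn.
    by rewrite -mulr_natl -/c mulVf // gt_eqF.
rewrite ler_peMl ?exprn_ege1 //; apply: ltW; apply: lper_pos.
  by rewrite all_map; apply/allP => j _; apply/posvP => i; rewrite mulr_gt0 ?invr_gt0 // ltr_wpDl.
by rewrite size_map size_iota cardsT hn.
Unshelve. all: by end_near. Qed.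

Lemma lper_regular_ge d (As : seq {set I}) : (0 < d)%N -> size As = #|I| ->
    {in As, forall A : {set I}, #|A| = d} -> (forall i, count (fun A : {set I} => i \in A) As = d) ->
  (d%:R / expR 1) ^+ #|I| <= lper [seq ind R A | A <- As] [set: I].
Proof.
move=> d0 hs hA hi.
have d0' : 0 < d%:R :> R by rewrite ltr0n.
pose a j i := d%:R^-1 * ind R (nth finset.set0 As j) i.
have := @lper_doubly_stochastic #|I| a erefl.
have -> : [seq a j | j <- iota 0 #|I|] =
    [seq (fun i => d%:R^-1 * b i) | b <- [seq ind R A | A <- As]].
  by rewrite -hs -[in RHS](mkseq_nth finset.set0 As) -!map_comp.
rewrite lper_scale !size_map hs => h.
have -> : (d%:R / expR 1) ^+ #|I| = expR (- #|I|%:R) * d%:R ^+ #|I| :> R.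
  by rewrite exprMn exprVn -expRM_natl mulr1 -expRN mulrC.
rewrite -ler_pdivlMr ?exprn_gt0 // -exprVn mulrC; apply: h.
- by move=> j i; rewrite mulr_ge0 ?invr_ge0 ?ler0n.
- move=> i; rewrite -mulr_sumr -(big_mkord predT (fun j => ind R (nth finset.set0 As j) i)) -hs.
  rewrite -(big_nth finset.set0 predT (fun A => ind R A i)) /ind.
  have -> : \sum_(A <- As) (i \in A)%:R = (count (fun A : {set I} => i \in A) As)%:R :> R.
    by elim: (As) => [|A s IH]; rewrite ?big_nil // big_cons IH /= natrD.
  by rewrite hi mulVf // gt_eqF.
- move=> j jn; rewrite -mulr_sumr /ind -hs in jn *.
  have -> : \sum_i ((i \in nth finset.set0 As j)%:R : R) = #|nth finset.set0 As j|%:R.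
    by rewrite -sum1_card natr_sum [RHS]big_mkcond; apply: eq_bigr => i _; case: ifP.
  by rewrite hA ?mem_nth // mulVf // gt_eqF.
Qed.

End DoublyStochastic.

(** * Bregman's inequality *)

Definition del_nth (T : Type) i (s : seq T) := take i s ++ drop i.+1 s.

Lemma size_del_nth (T : Type) i (s : seq T) : (i < size s)%N -> (size (del_nth i s)).+1 = size s.
Proof. by move=> hi; rewrite size_cat size_take size_drop hi; lia. Qed.

Lemma map_del_nth (T T' : Type) (f : T -> T') i s : map f (del_nth i s) = del_nth i (map f s).
Proof. by rewrite /del_nth map_cat map_take map_drop. Qed.

Lemma big_del_nth (R : zmodType) (T : Type) (x0 : T) i s (F : T -> R) : (i < size s)%N ->
  \sum_(x <- del_nth i s) F x = \sum_(x <- s) F x - F (nth x0 s i).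
Proof.
move=> hi; rewrite -[in RHS](cat_take_drop i s) (drop_nth x0) // /del_nth !big_cat /=.
rewrite big_cons nth_cat size_take hi ltnn subnn /= addrCA.
by rewrite [F _ + _]addrC addrK.
Qed.

Section Expansions.
Variables (R : comNzRingType) (I : finType) (a0 : I -> R).
Implicit Types (l : seq (I -> R)) (V : {set I}).

Lemma lper_row l V i : (i < size l)%N ->
  lper l V = \sum_(k in V) nth a0 l i k * lper (del_nth i l) (V :\ k).
Proof.
by move=> hi; rewrite -{1}(cat_take_drop i l) (drop_nth a0) // lper_move lper_cons.
Qed.

Lemma lper_col l V k : size l = #|V| -> k \in V ->
  lper l V = \sum_(i < size l) nth a0 l i k * lper (del_nth i l) (V :\ k).
Proof.
elim: l V => [|a l IH] V hV kV.
  by move: hV; rewrite (cardsD1 k) kV.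
rewrite /= big_ord_recl /= /del_nth /= drop0 lper_cons (big_setD1 k) //=; congr (_ + _).
have hD j : j \in V -> size l = #|V :\ j|.
  by move=> jV; move: hV => /=; rewrite (cardsD1 j) jV => -[].
under eq_bigr => j.
  rewrite !inE => /andP[njk jV].
  have kj : k \in V :\ j by rewrite !inE eq_sym njk.
  rewrite (IH (V :\ j) (hD j jV) kj) mulr_sumr; over.
rewrite exchange_big /=; apply: eq_bigr => i _.
rewrite lper_cons mulr_sumr; apply: eq_bigr => j _.
by rewrite mulrCA setD1C.
Qed.

End Expansions.

Section Bregman.
Variables (R : realType) (I : finType).
Implicit Types (As : seq {set I}) (V : {set I}).

(** x ln x lies above its tangent at the mean a = s / |K|; summing the tangent bounds leaves s ln a.
    Terms with x = 0 are treated apart. *)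
Lemma sum_xlnx_ge (K : {set I}) (x : I -> R) (s : R) : 0 < s ->
    (forall k, k \in K -> 0 <= x k) -> \sum_(k in K) x k = s ->
  s * (ln s - ln #|K|%:R) <= \sum_(k in K) x k * ln (x k).
Proof.
move=> s0 hx hs.
have K0 : 0 < #|K|%:R :> R.
  rewrite ltr0n lt0n; apply/eqP => /cards0_eq K0; move: s0.
  by rewrite -hs K0 big_set0 ltxx.
pose a := s / #|K|%:R; have a0 : 0 < a by rewrite divr_gt0.
rewrite -ln_div ?posrE // -/a.
have h k : k \in K -> x k * ln a + x k - a <= x k * ln (x k).
  move=> kK; have := hx k kK; rewrite le_eqVlt => /predU1P[<-|xk0].
    by rewrite !mul0r; lra.
  have := ln_le_sub1 (divr_gt0 a0 xk0); rewrite ln_div ?posrE // => hl.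
  have := ler_wpM2l (ltW xk0) hl.
  by rewrite !mulrBr mulr1 mulrCA divff ?gt_eqF // mulr1; lra.
apply: le_trans (ler_sum _ h); rewrite big_split big_split /= -mulr_suml hs.
rewrite sumr_const -mulr_natl /a mulrN mulrCA divff ?gt_eqF // mulr1 addrK.
by [].
Qed.

(** The logarithm of Bregman's factor (r!)^(1/r), with value 0 at r = 0. *)
Definition lnfact_mean (r : nat) : R := ln r`!%:R / r%:R.

Lemma lnfact_meanK r : (0 < r)%N -> r%:R * lnfact_mean r = ln r`!%:R.
Proof. by move=> r0; rewrite mulrC divfK // pnatr_eq0 -lt0n. Qed.

Lemma lper_ind_ge0 As V : 0 <= lper [seq ind R A | A <- As] V.
Proof.
elim: As V => [|A As IH] V /=; first by rewrite lper_nil.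
by rewrite lper_cons sumr_ge0 // => i _; rewrite mulr_ge0 ?ler0n.
Qed.

(* Schrijver's proof: convexity of x ln x along each row, then induction on the
   minors, the exponents being regrouped by the column expansion. *)
Theorem bregman As V : size As = #|V| -> 0 < lper [seq ind R A | A <- As] V ->
  ln (lper [seq ind R A | A <- As] V) <= \sum_(A <- As) lnfact_mean #|A :&: V|.
Proof.
move: {2}(size As) (erefl (size As)) => N.
elim: N As V => [|N IH] As V hN hV.
  by move: hN => /size0nil->; rewrite big_nil lper_nil ln1.
set p := lper _ V => p0.
pose A i := nth finset.set0 As i.
pose r i := #|A i :&: V|.
pose q i k : R := lper [seq ind R B | B <- del_nth i As] (V :\ k).
pose x i k := ind R (A i) k * q i k.
pose h j k := lnfact_mean #|A j :&: (V :\ k)|.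
have x0 i k : 0 <= x i k by rewrite mulr_ge0 ?ler0n ?lper_ind_ge0.
have row i : (i < N.+1)%N -> \sum_(k in V) x i k = p.
  move=> hi; rewrite /p (@lper_row R I (ind R finset.set0) _ _ i) ?size_map ?hN //.
  by apply: eq_bigr => k _; rewrite (nth_map finset.set0) ?hN // -map_del_nth.
have col k : k \in V -> \sum_(i < N.+1) x i k = p.
  move=> kV; rewrite /p (@lper_col R I (ind R finset.set0) _ _ k) ?size_map ?hN -?hV //.
  by apply: eq_bigr => i _; rewrite (nth_map finset.set0) ?hN // -map_del_nth.
have row' i : (i < N.+1)%N -> \sum_(k in A i :&: V) x i k = p.
  move=> hi; rewrite -(row i hi) [RHS](big_setID (A i)) /= finset.setIC [X in _ = _ + X]big1 ?addr0 //.
  by move=> k; rewrite !inE => /andP[/negPf kA _]; rewrite /x /ind kA mul0r.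
have r0 i : (i < N.+1)%N -> (0 < r i)%N.
  move=> hi; rewrite /r lt0n; apply/eqP => /cards0_eq e0.
  by move: p0; rewrite -(row' i hi) e0 big_set0 ltxx.
have hr i k : k \in V -> #|A i :&: (V :\ k)| = (r i - (k \in A i))%N.
  move=> kV; rewrite /r finset.setIDA (cardsD1 k (A i :&: V)) inE kV andbT.
  by rewrite addKn.
(* By induction ln (q i k) is at most the sum of the h j k over the rows j other than i; the
   left-hand side comes from convexity on the support of row i. *)
have ent i : (i < N.+1)%N -> p * (ln p - ln (r i)%:R) <=
    \sum_(k in V) x i k * (\sum_(j < N.+1) h j k - h i k).
  move=> hi; apply: le_trans (sum_xlnx_ge p0 (fun k _ => x0 i k) (row' i hi)) _.
  rewrite [X in _ <= X](big_setID (A i)) /= finset.setIC [X in _ <= _ + X]big1 ?addr0; last first.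
    by move=> k; rewrite !inE => /andP[/negPf kA _]; rewrite /x /ind kA !mul0r.
  apply: ler_sum => k; rewrite inE => /andP[kV kA].
  have xE : x i k = q i k by rewrite /x /ind kA mul1r.
  have := x0 i k; rewrite le_eqVlt => /predU1P[<-|xk0]; first by rewrite !mul0r.
  apply: ler_wpM2l => //; rewrite xE in xk0 *.
  have sd : size (del_nth i As) = N by apply/eqP; rewrite -eqSS size_del_nth ?hN.
  have := IH (del_nth i As) (V :\ k) sd; rewrite sd.
  move=> /(_ _ xk0) /le_trans; apply.
    by have := cardsD1 k V; rewrite kV -hV hN => -[].
  rewrite (big_del_nth finset.set0) ?hN // (big_nth finset.set0) hN big_mkord.
  by [].
have key : \sum_(i < N.+1) p * (ln p - ln (r i)%:R) <=
    p * \sum_(i < N.+1) (N.+1%:R * lnfact_mean (r i) - ln (r i)%:R).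
  apply: le_trans (ler_sum _ (fun (i : 'I_N.+1) _ => ent i (ltn_ord i))) _.
  have -> : \sum_(i < N.+1) \sum_(k in V) x i k * (\sum_(j < N.+1) h j k - h i k) =
      \sum_(k in V) \sum_(i < N.+1) x i k * (\sum_(j < N.+1) h j k) -
      \sum_(i < N.+1) \sum_(k in V) x i k * h i k.
    rewrite [X in _ = X - _]exchange_big /= -sumrB; apply: eq_bigr => i _.
    by rewrite -sumrB; apply: eq_bigr => k _; rewrite mulrBr.
  have -> : \sum_(k in V) \sum_(i < N.+1) x i k * (\sum_(j < N.+1) h j k) =
      p * \sum_(j < N.+1) \sum_(k in V) h j k.
    rewrite [in RHS]exchange_big /= mulr_sumr; apply: eq_bigr => k kV.
    by rewrite -mulr_suml col.
  have -> : \sum_(i < N.+1) \sum_(k in V) x i k * h i k =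
      p * \sum_(i < N.+1) lnfact_mean (r i).-1.
    rewrite mulr_sumr; apply: eq_bigr => i _.
    rewrite -(row i (ltn_ord i)) mulr_suml; apply: eq_bigr => k kV.
    rewrite /x /ind /h hr //; case: (k \in A i); last by rewrite !mul0r.
    by rewrite subn1.
  rewrite -mulrBr ler_pM2l // -sumrB le_eqVlt; apply/orP; left; apply/eqP.
  apply: eq_bigr => i _; have ri := r0 i (ltn_ord i).
  have -> : \sum_(k in V) h i k = (r i)%:R * lnfact_mean (r i).-1 +
      (N.+1%:R - (r i)%:R) * lnfact_mean (r i).
    rewrite (big_setID (A i)) /= finset.setIC; congr (_ + _).
      rewrite mulr_natl -sumr_const; apply: eq_bigr => k; rewrite inE => /andP[kA kV].
      by rewrite /h hr // kA subn1.
    have -> : N.+1%:R - (r i)%:R = #|V :\: A i|%:R :> R.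
      have := cardsID (A i) V; rewrite -hV hN finset.setIC => /(congr1 (fun m => m%:R : R)).
      by rewrite natrD -/(r i) => <-; rewrite addrC addKr.
    rewrite mulr_natl -sumr_const; apply: eq_bigr => k; rewrite inE => /andP[/negPf kA kV].
    by rewrite /h hr // kA subn0.
  (* Row i now carries (r-1) times the mean at r-1, that is ln (r-1)! = ln r! - ln r, plus N+1-r
     times the mean at r. The term ln r! completes the latter to N+1 times the mean at r, and the
     remaining - ln r cancels against the left-hand side of [key]. *)
  have e1 : (r i)%:R * lnfact_mean (r i) = ln (r i)`!%:R by exact: lnfact_meanK.
  have e2 : ((r i)%:R - 1) * lnfact_mean (r i).-1 = ln ((r i).-1)`!%:R.
    rewrite -[1]/(1%:R) -natrB // subn1; case: (r i).-1 => [|m]; last exact: lnfact_meanK.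
    by rewrite mul0r fact0 ln1.
  have e3 : ln (r i)`!%:R = ln (r i)%:R + ln ((r i).-1)`!%:R :> R.
    by rewrite -{1}(prednK ri) factS prednK // natrM lnM // posrE ltr0n ?fact_gt0.
  move: e1 e2 e3; lra.
move: key; rewrite -mulr_sumr ler_pM2l // !sumrB lerD2r sumr_const card_ord.
rewrite -mulr_sumr -[ln p *+ _]mulr_natl ler_pM2l ?ltr0n // => /le_trans; apply.
by rewrite (big_nth finset.set0) hN big_mkord.
Qed.

End Bregman.

(** * Counting estimates *)

Lemma uniq_map_in_inj (T U : eqType) (f : T -> U) (s : seq T) :
  uniq (map f s) -> {in s &, injective f}.
Proof.
elim: s => //= x s IH /andP[hx hu] y z; rewrite !inE.
case/predU1P => [->|ys] /predU1P[->|zs] //.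
- by move=> e; move: hx; rewrite e map_f.
- by move=> e; move: hx; rewrite -e map_f.
- exact: IH.
Qed.

Lemma mulr_sizel (R : pzSemiRingType) (T : Type) (s : seq T) (b : R) :
  (size s)%:R * b = \sum_(x <- s) b.
Proof.
elim: s => [|x s IH]; first by rewrite big_nil mul0r.
by rewrite big_cons -IH -natr1 mulrDl mul1r addrC.
Qed.

(* The added rows of ones count the orderings of the unused columns. *)
Lemma lper_pad (R : comNzRingType) (I : finType) (l : seq (I -> R)) m (V : {set I}) :
    (size l + m)%N = #|V| ->
  lper (l ++ nseq m (ind R [set: I])) V = lper l V * m`!%:R.
Proof.
elim: l V => [|a l IH] V hV.
  rewrite cat0s lper_nseq // lper_nil big1 ?mulr1 ?mul1r // => i _.
  by rewrite /ind finset.in_setT.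
rewrite cat_cons !lper_cons mulr_suml; apply: eq_bigr => i iV.
by rewrite -mulrA IH //; move: hV; rewrite (cardsD1 i) iV /= => -[].
Qed.

(** * Lower bound: Latin squares row by row *)

Section FullRows.
Variable J : finType.
Implicit Types (y : seq (J * J)) (t : seq (seq (J * J))).

Lemma full_row_symbol y k : unzip1 y = enum [set: J] -> uniq (unzip2 y) ->
  exists j, forall j', ((j', k) \in y) = (j' == j).
Proof.
move=> hy hu; have sz : size (unzip2 y) = #|J|.
  by rewrite size_map -(size_map fst) -/(unzip1 y) hy -cardE cardsT.
have : k \in unzip2 y.
  have /(uniq_min_size hu)[|_ ->] : {subset unzip2 y <= enum J} by move=> x _; rewrite mem_enum.
    by rewrite sz cardE.
  by rewrite mem_enum.
case/mapP => -[j k'] hj /= ->; exists j => j'; apply/idP/eqP => [h|->//].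
by have [] := uniq_map_in_inj hu h hj erefl.
Qed.

(** Together with [card_used], this makes the bipartite graph of columns and symbols still allowed
    regular of degree |J| - r. *)
Lemma card_used_full r t k : t \in pls_words J (nseq r [set: J]) ->
  #|[set j | k \in used t j]| = r.
Proof.
elim: r t => [|r IH] [|y t].
- by move=> _; apply: eq_card0 => j; rewrite !inE.
- by rewrite inE.
- by move/size_mem_pls_words.
rewrite mem_pls_words_cons => /and4P[ht /eqP hy hu hA].
have [j hj] := full_row_symbol k hy hu.
have -> : [set j' | k \in used (y :: t) j'] = j |: [set j' | k \in used t j'].
  by apply/setP => j'; rewrite inE used_cons !inE hj.
rewrite cardsU1 IH // inE (_ : k \notin used t j) //.
by apply: (allP hA (j, k)); rewrite hj.
Qed.

Variable R : realType.

Lemma size_pls_words_full_ge r : (r <= #|J|)%N ->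
  \prod_(i < r) ((#|J| - i)%:R / expR 1) ^+ #|J| <=
  (size (pls_words J (nseq r [set: J])))%:R :> R.
Proof.
elim: r => [|r IH] hr; first by rewrite big_ord0.
rewrite big_ord_recr /= -[in X in _ <= X]/(nseq r.+1 [set: J]) size_pls_words_cons natr_sum.
set b := (_ / _) ^+ _.
apply: le_trans (_ : (size (pls_words J (nseq r [set: J])))%:R * b <= _).
  apply: ler_wpM2r; last by apply: IH; exact: ltnW.
  by rewrite exprn_ge0 // divr_ge0 ?expR_ge0.
rewrite mulr_sizel big_seq [X in _ <= X]big_seq; apply: ler_sum => t ht.
rewrite (size_fillings R) (map_comp (@ind R J) (fun j => ~: used t j)).
apply: lper_regular_ge; first by rewrite subn_gt0.
- by rewrite size_map -cardE cardsT.
- move=> A /mapP[j _ ->]; rewrite cardsCs finset.setCK (card_used _ ht).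
  by rewrite count_nseq finset.in_setT mul1n.
- move=> k; rewrite -(card_used_full k ht) -[in RHS](finset.setCK [set j | _]) -cardsCs.
  rewrite count_map -size_filter.
  rewrite -(card_uniqP (filter_uniq _ (enum_uniq _))).
  by apply: eq_card => j; rewrite mem_filter mem_enum !inE andbT.
Qed.

End FullRows.

(** * Upper bound: partial squares with a given set of filled cells *)

Section UpperBound.
Variables (R : realType) (J : finType).
Implicit Types (Fs : seq {set J}).
Let n := #|J|.

(** The share of a column with c filled cells: n - i symbols are allowed when its cell number i,
    counted from 0, is entered. *)
Definition column_sum (c : nat) : R := \sum_(i < c) lnfact_mean R (n - i).

(** The cost of padding: n - |F| all-one rows enter Bregman's bound, and the permanent they multiply
    by (n - |F|)! is recovered by subtraction. *)
Definition row_term (F : {set J}) : R :=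
  (n - #|F|)%:R * lnfact_mean R n - ln (n - #|F|)`!%:R.

(** Bregman's inequality for the matrix of allowed symbols, padded to a square one. By [card_used]
    its row sums depend on t only through Fs, so the bounds of successive rows can be multiplied. A
    row without fillings is trivial. *)
Lemma size_row_le Fs (F : {set J}) t : t \in pls_words J Fs ->
  (size (fillings (enum F) (fun j => ~: used t j) [set: J]))%:R <=
  expR (\sum_(j in F) lnfact_mean R (n - count (fun F : {set J} => j \in F) Fs)
        + row_term F).
Proof.
move=> ht; rewrite (size_fillings R) (map_comp (@ind R J) (fun j => ~: used t j)).
set As := map _ (enum F); set X := lper _ _.
have := lper_ind_ge0 R As [set: J]; rewrite -/X le_eqVlt => /predU1P[<-|X0].
  exact: expR_ge0.
set m := (n - #|F|)%N.
have hs : (size As + m)%N = #|[set: J]|.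
  by rewrite size_map -cardE cardsT subnKC // max_card.
have hp : lper [seq ind R A | A <- As ++ nseq m [set: J]] [set: J] = X * m`!%:R.
  by rewrite map_cat map_nseq lper_pad // size_map.
have m0 : 0 < m`!%:R :> R by rewrite ltr0n fact_gt0.
have := @bregman R J (As ++ nseq m [set: J]) [set: J].
rewrite hp size_cat size_nseq hs mulr_gt0 // => /(_ erefl isT).
rewrite lnM ?posrE // -lerBrDr => h.
rewrite -(lnK X0) ler_expR; apply: le_trans h _.
rewrite /row_term -/m addrA lerD2r big_cat /= lerD //.
  rewrite big_map big_enum /= ler_sum // => j _.
  by rewrite finset.setIT cardsCs finset.setCK (card_used _ ht).
rewrite big_nseq finset.setIT cardsT -/n; elim: (m) => [|k IH] /=; first by rewrite mul0r.
by rewrite -natr1 mulrDl mul1r addrC lerD2r.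
Qed.

Lemma size_pls_words_le Fs : (size (pls_words J Fs))%:R <=
  expR (\sum_j column_sum (count (fun F : {set J} => j \in F) Fs)
        + \sum_(F <- Fs) row_term F).
Proof.
elim: Fs => [|F Fs IH].
  by rewrite big_nil big1 ?addr0 ?expR0 // => j _; rewrite /column_sum big_ord0.
rewrite size_pls_words_cons natr_sum big_cons.
have -> : \sum_j column_sum (count (fun F : {set J} => j \in F) (F :: Fs)) =
    \sum_j column_sum (count (fun F : {set J} => j \in F) Fs) +
    \sum_(j in F) lnfact_mean R (n - count (fun F : {set J} => j \in F) Fs).
  rewrite [X in _ + X]big_mkcond -big_split /=; apply: eq_bigr => j _.
  case: (j \in F); last by rewrite addr0.
  by rewrite add1n /column_sum big_ord_recr.
set a := \sum_j _; set b := \sum_(j in F) _; set c := \sum_(F <- Fs) _.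
have -> : a + b + (row_term F + c) = (a + c) + (b + row_term F) by ring.
rewrite expRD; apply: le_trans (_ : (size (pls_words J Fs))%:R * expR (b + row_term F) <= _).
  rewrite mulr_sizel big_seq [X in _ <= X]big_seq.
  by apply: ler_sum => t ht; exact: size_row_le.
by apply: ler_wpM2r => //; exact: expR_ge0.
Qed.

End UpperBound.

(** * Logarithmic estimates and comparison of the two counts *)

Section Estimates.
Variable R : realType.
Local Notation ln := (@ln R).

Lemma lnS_sub_ge n : (0 < n)%N -> n.+1%:R^-1 <= ln n.+1%:R - ln n%:R.
Proof.
move=> n0; have n0' : 0 < n%:R :> R by rewrite ltr0n.
have n1 : 0 < n.+1%:R :> R by rewrite ltr0n.
have := ln_le_sub1 (divr_gt0 n0' n1); rewrite ln_div ?posrE //.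
have -> : n%:R / n.+1%:R - 1 = - n.+1%:R^-1 :> R.
  by rewrite -natr1; field; rewrite natr1 gt_eqF.
by rewrite -lerN2 opprB.
Qed.

(** n^n / n! is one term of the exponential series at n. *)
Lemma ln_fact_ge n : n%:R * ln n%:R - n%:R <= ln n`!%:R.
Proof.
case: n => [|n]; first by rewrite mul0r subr0 fact0 ln1.
have n0 : 0 < n.+1%:R :> R by rewrite ltr0n.
have f0 : 0 < n.+1`!%:R :> R by rewrite ltr0n fact_gt0.
have h := expR_ge1Dxn n (ltW n0).
have : n.+1%:R ^+ n.+1 / n.+1`!%:R <= expR n.+1%:R :> R by apply: le_trans h; rewrite lerDr.
rewrite -ler_ln ?posrE ?expR_gt0 ?divr_gt0 ?exprn_gt0 // expRK.
rewrite ln_div ?posrE ?exprn_gt0 // lnXn // -mulr_natl; lra.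
Qed.

Lemma ln_fact_le n : (0 < n)%N ->
  ln n`!%:R <= n%:R * ln n%:R - n%:R + ln n%:R + 1.
Proof.
case: n => // n _; elim: n => [|n IH]; first by rewrite ln1; lra.
have h := lnS_sub_ge (ltn0Sn n).
have n0 : 0 < n.+2%:R :> R by rewrite ltr0n.
rewrite factS natrM lnM ?posrE ?ltr0n ?fact_gt0 //.
have : 1 <= n.+2%:R * (ln n.+2%:R - ln n.+1%:R) by rewrite mulrC -ler_pdivrMr // mul1r.
move: IH; rewrite -[n.+2%:R]natr1 => IH; rewrite [_ * (_ - _)]mulrBr.
nra.
Qed.

Definition harm (n : nat) : R := \sum_(i < n) i.+1%:R^-1.

Lemma harm_le n : (0 < n)%N -> harm n <= 1 + ln n%:R.
Proof.
case: n => // n _; elim: n => [|n IH].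
  by rewrite /harm big_ord_recr big_ord0 /= ln1 invr1 add0r addr0.
rewrite /harm big_ord_recr /=; apply: le_trans (lerD IH (lnS_sub_ge (ltn0Sn n))) _.
by rewrite -addrA subrKC.
Qed.

Lemma harm_ge0 n : 0 <= harm n.
Proof. by apply: sumr_ge0 => i _; rewrite invr_ge0. Qed.

Section FixN.
Variable n : nat.
Hypothesis n0 : (0 < n)%N.
Let L := ln n%:R.

Let n0' : 0 < n%:R :> R. Proof. by rewrite ltr0n. Qed.
Let L0 : 0 <= L. Proof. by apply: ln_ge0; rewrite ler1n. Qed.

Lemma lnfact_mean_le d : (d < n)%N ->
  lnfact_mean R d.+1 <= ln d.+1%:R - 1 + (L + 1) / d.+1%:R.
Proof.
move=> dn; have d0 : 0 < d.+1%:R :> R by rewrite ltr0n.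
rewrite /lnfact_mean ler_pdivrMr // mulrDl divfK ?gt_eqF //.
have := ln_fact_le (ltn0Sn d).
have : ln d.+1%:R <= L by rewrite /L ler_ln ?posrE // ler_nat.
lra.
Qed.

(** A potential whose increments are the bounds of [lnfact_mean_le], so that column sums
    telescope. *)
Let phi d : R := ln d`!%:R - d%:R + (L + 1) * harm d.

Let phiS d : (d < n)%N -> lnfact_mean R d.+1 <= phi d.+1 - phi d.
Proof.
move=> dn; apply: le_trans (lnfact_mean_le dn) _.
rewrite /phi /harm big_ord_recr /= factS natrM lnM ?posrE ?ltr0n ?fact_gt0 //.
by rewrite -natr1; lra.
Qed.

(** Here c counts the empty cells of the column; telescoping gives phi n - phi c. *)
Lemma column_sum_le c : (c <= n)%N ->
  column_sum R 'I_n (n - c) <=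
  n%:R * L - 2 * n%:R - c%:R * ln c%:R + 2 * c%:R + (L + 1) + (L + 1) ^+ 2.
Proof.
move=> cn.
have tel a : (a <= n)%N -> column_sum R 'I_n a <= phi n - phi (n - a)%N.
  elim: a => [|a IH] an; first by rewrite /column_sum big_ord0 subn0 subrr.
  rewrite /column_sum big_ord_recr /= -/(column_sum _ _ _) card_ord.
  have e : (n - a = (n - a.+1).+1)%N by lia.
  have := phiS (d := (n - a.+1)%N); rewrite -e => /(_ ltac:(lia)).
  by have := IH (ltnW an); lra.
apply: le_trans (tel _ (leq_subr _ _)) _; rewrite subKn // /phi.
have h1 := ln_fact_le n0; have h2 := ln_fact_ge c; rewrite -/L in h1.
have h3 : (L + 1) * harm n <= (L + 1) ^+ 2.
  by rewrite expr2 ler_wpM2l ?addr_ge0 // addrC harm_le.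
have h4 : 0 <= (L + 1) * harm c by rewrite mulr_ge0 ?harm_ge0 ?addr_ge0.
lra.
Qed.

Lemma row_term_le (F : {set 'I_n}) (r := (n - #|F|)%N) :
  row_term R F <= r%:R * L - r%:R * ln r%:R + (L + 1).
Proof.
rewrite /row_term card_ord -/r.
have rn : r%:R / n%:R <= 1 :> R by rewrite ler_pdivrMr // mul1r ler_nat leq_subr.
have r0 : 0 <= r%:R / n%:R :> R by rewrite divr_ge0.
have h1 := ln_fact_le n0; have h2 := ln_fact_ge r; rewrite -/L in h1.
have : r%:R / n%:R * ln n`!%:R <= r%:R / n%:R * (n%:R * L - n%:R + L + 1).
  exact: ler_wpM2l.
have -> : r%:R / n%:R * (n%:R * L - n%:R + L + 1) =
    r%:R * L - r%:R + r%:R / n%:R * (L + 1) by field; rewrite gt_eqF.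
have : r%:R / n%:R * (L + 1) <= L + 1 by rewrite ler_piMl ?addr_ge0.
rewrite /lnfact_mean mulrCA mulrC; lra.
Qed.

(** The extreme case is m empty cells spread evenly over n lines; used for rows and for columns. *)
Lemma sum_nat_xlnx (c : 'I_n -> nat) m : (0 < m)%N -> (\sum_j c j = m)%N ->
  m%:R * (ln m%:R - L) <= \sum_j (c j)%:R * ln (c j)%:R.
Proof.
move=> m0 hm; have := @sum_xlnx_ge R 'I_n [set: 'I_n] (fun j => (c j)%:R) m%:R.
rewrite cardsT card_ord -/L ltr0n => /(_ m0 (fun j _ => ler0n _ _)).
have e (f : 'I_n -> R) : \sum_(j in [set: 'I_n]) f j = \sum_j f j.
  by apply: eq_bigl => j; rewrite inE.
by rewrite !e -natr_sum hm => /(_ erefl).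
Qed.

Lemma size_pls_words_cells_le (E : {set 'I_n * 'I_n}) m : (0 < m)%N -> (#|E| + m = n ^ 2)%N ->
  (size (pls_words 'I_n (map (row_cells E) (enum 'I_n))))%:R <=
  expR (n%:R ^+ 2 * L - 2 * n%:R ^+ 2 - 2 * m%:R * ln m%:R + 3 * m%:R * L
        + 2 * m%:R + 2 * n%:R * (L + 1) + n%:R * (L + 1) ^+ 2).
Proof.
move=> m0 hE; apply: le_trans (size_pls_words_le R _) _; rewrite ler_expR.
pose cnt (j : 'I_n) := count (fun F : {set 'I_n} => j \in F) (map (row_cells E) (enum 'I_n)).
have cntE j : cnt j = (\sum_(i < n) ((i, j) \in E))%N.
  rewrite /cnt count_map -sum1_count big_enum_cond big_mkcond /=.
  by apply: eq_bigr => i _; rewrite inE; case: ifP.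
have rowE i : #|row_cells E i| = (\sum_(j < n) ((i, j) \in E))%N.
  by rewrite -sum1_card big_mkcond; apply: eq_bigr => j _; rewrite inE; case: ifP.
have EE : #|E| = (\sum_(i < n) \sum_(j < n) ((i, j) \in E))%N.
  rewrite pair_big -sum1_card big_mkcond; apply: eq_bigr => -[i j] _ /=.
  by case: ifP.
have cn j : (cnt j <= n)%N.
  by rewrite cntE -[leqRHS]card_ord -sum1_card leq_sum // => i _; case: (_ \in _).
have rn i : (#|row_cells E i| <= n)%N by rewrite -[leqRHS]card_ord max_card.
have sn : (\sum_(j < n) n = n ^ 2)%N by rewrite sum_nat_const card_ord mulnn.
have sc : (\sum_j (n - cnt j) = m)%N.
  rewrite sumnB // sn; have -> : (\sum_j cnt j = #|E|)%N.
    by rewrite EE exchange_big; apply: eq_bigr.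
  by rewrite -hE addKn.
have sr : (\sum_i (n - #|row_cells E i|) = m)%N.
  rewrite sumnB // sn; have -> : (\sum_i #|row_cells E i| = #|E|)%N.
    by rewrite EE; apply: eq_bigr.
  by rewrite -hE addKn.
have h1 : \sum_j column_sum R 'I_n (cnt j) <= \sum_(j < n)
    (n%:R * L - 2 * n%:R - (n - cnt j)%:R * ln (n - cnt j)%:R + 2 * (n - cnt j)%:R +
     ((L + 1) + (L + 1) ^+ 2)).
  apply: ler_sum => j _; rewrite -{1}(subKn (cn j)) addrA.
  by apply: column_sum_le; exact: leq_subr.
have h2 : \sum_(F <- map (row_cells E) (enum 'I_n)) row_term R F <= \sum_(i < n)
    ((n - #|row_cells E i|)%:R * L - (n - #|row_cells E i|)%:R * ln (n - #|row_cells E i|)%:R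
     + (L + 1)).
  by rewrite big_map big_enum; apply: ler_sum => i _; exact: row_term_le.
apply: le_trans (lerD h1 h2) _.
have sumc (x : R) : \sum_(j < n) x = n%:R * x by rewrite sumr_const card_ord mulr_natl.
rewrite !big_split /= !sumrN -!mulr_sumr -!mulr_suml -!natr_sum sc sr !sumc.
have := sum_nat_xlnx m0 sc; have := sum_nat_xlnx m0 sr.
rewrite sn natrX; lra.
Qed.

Lemma ln_bin_le N m : (0 < N)%N -> (m <= N)%N ->
  ln 'C(N, m)%:R <= m%:R * ln N%:R - m%:R * ln m%:R + m%:R.
Proof.
move=> N0 mN; have h : (N ^_ m <= N ^ m)%N.
  elim: (m) => [|k IH]; first by rewrite ffactn0.
  by rewrite ffactnSr expnSr leq_mul // leq_subr.
have : 'C(N, m)%:R * m`!%:R <= N%:R ^+ m :> R by rewrite -natrM bin_ffact -natrX ler_nat.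
rewrite -ler_ln ?posrE ?mulr_gt0 ?exprn_gt0 ?ltr0n ?fact_gt0 ?bin_gt0 //.
rewrite lnM ?posrE ?ltr0n ?fact_gt0 ?bin_gt0 // lnXn ?ltr0n // -mulr_natl.
by have := ln_fact_ge m; lra.
Qed.

Lemma card_latin_squares_ge :
  expR (n%:R ^+ 2 * L - 2 * n%:R ^+ 2) <= #|latin_squares n|%:R :> R.
Proof.
have h : (size (pls_words 'I_n (nseq n [set: 'I_n])))%:R <= #|latin_squares n|%:R :> R.
  by rewrite ler_nat card_latin_ge.
apply: le_trans h; have := @size_pls_words_full_ge 'I_n R n; rewrite card_ord => /(_ (leqnn n)).
apply: le_trans.
have -> : \prod_(i < n) ((n - i)%:R / expR 1) ^+ n = (n`!%:R / expR n%:R) ^+ n :> R.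
  rewrite prodrXl; congr (_ ^+ n); rewrite prodf_div prodr_const card_ord -expRM_natl mulr1.
  congr (_ / _); rewrite -natr_prod fact_prod big_add1 /= big_mkord; congr _%:R.
  rewrite (reindex_inj rev_ord_inj); apply: eq_bigr => i _ /=.
  by rewrite subKn // ltn_ord.
have f0 : 0 < n`!%:R / expR n%:R :> R by rewrite divr_gt0 ?expR_gt0 ?ltr0n ?fact_gt0.
rewrite -[X in _ <= X]lnK ?posrE ?exprn_gt0 // ler_expR lnXn // -mulr_natl.
rewrite ln_div ?posrE ?expR_gt0 ?ltr0n ?fact_gt0 // expRK.
have := ler_wpM2l (ltW n0') (ln_fact_ge n); rewrite -/L; nra.
Qed.

Lemma card_partial_squares_le m : (0 < m <= n ^ 2)%N ->
  #|partial_squares (latin_squares n) (n ^ 2 - m)%N|%:R <=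
  expR (n%:R ^+ 2 * L - 2 * n%:R ^+ 2 + m%:R * (3 + 5 * L - 3 * ln m%:R)
        + 2 * n%:R * (L + 1) + n%:R * (L + 1) ^+ 2).
Proof.
move=> /andP[m0 mn].
have h := card_partial_squares n (n ^ 2 - m)%N.
set b := expR (n%:R ^+ 2 * L - 2 * n%:R ^+ 2 - 2 * m%:R * ln m%:R + 3 * m%:R * L
        + 2 * m%:R + 2 * n%:R * (L + 1) + n%:R * (L + 1) ^+ 2).
apply: (@le_trans _ _ ('C(n ^ 2, m)%:R * b)).
  apply: (@le_trans _ _ (\sum_(E : {set 'I_n * 'I_n} | #|E| == (n ^ 2 - m)%N) b)).
    apply: (@le_trans _ _ (\sum_(E : {set 'I_n * 'I_n} | #|E| == (n ^ 2 - m)%N)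
      size (pls_words 'I_n (map (row_cells E) (enum 'I_n))))%:R); first by rewrite ler_nat.
    rewrite natr_sum; apply: ler_sum => E /eqP hE.
    by apply: size_pls_words_cells_le => //; rewrite hE subnK.
  rewrite sumr_const -[b *+ _]mulr_natl le_eqVlt; apply/orP; left; apply/eqP; congr (_%:R * _).
  rewrite -(bin_sub mn) -[in RHS](_ : #|[set: 'I_n * 'I_n]| = (n ^ 2)%N); last first.
    by rewrite cardsT card_prod !card_ord mulnn.
  rewrite -cards_draws; apply: eq_card => E.
  by rewrite inE finset.subsetT cardsT card_prod !card_ord mulnn.
have c0 : 0 < 'C(n ^ 2, m)%:R :> R by rewrite ltr0n bin_gt0.
rewrite -(lnK (x := 'C(n ^ 2, m)%:R)) ?posrE // -expRD ler_expR.
have := ln_bin_le (N := (n ^ 2)%N) _ mn; rewrite expn_gt0 n0 => /(_ isT).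
rewrite natrX lnXn // -mulr_natl -/L; lra.
Qed.

Lemma RTD_gt m : (0 < m <= n ^ 2)%N ->
  3 * n%:R * (L + 1) ^+ 2 < m%:R * (3 * ln m%:R - 5 * L - 3) ->
  (n ^ 2 - m < RTD (latin_squares n))%N.
Proof.
move=> hm hlt; rewrite ltnNge; apply/negP => hk.
have : (#|latin_squares n| <= #|partial_squares (latin_squares n) (n ^ 2 - m)%N|)%N.
  by apply: card_le_partial_squares; rewrite ?hk ?leq_subr.
rewrite -(ler_nat R) => h.
have := le_trans (le_trans card_latin_squares_ge h) (card_partial_squares_le hm).
rewrite ler_expR.
(* This merges both error terms into 3 n (L + 1)^2. *)
have : n%:R * (L + 1) <= n%:R * (L + 1) ^+ 2.
  by rewrite ler_pM2l // expr2 ler_peMr ?addr_ge0 // lerDr.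
lra.
Qed.

End FixN.
End Estimates.

(** * Choice of the number of empty cells *)

Local Open Scope classical_set_scope.
Local Open Scope ring_scope.

Lemma RTD_latin_squares_ge (R : realType) (n : nat) : (0 < n)%N ->
  (n%:R : R) ^+ 2 - (expR 1 + 37 * expR (- (ln n%:R / 3))) * expR (5 / 3 * ln n%:R)
    <= (RTD (latin_squares n))%:R.
Proof.
move=> n0; have n0' : 0 < n%:R :> R by rewrite ltr0n.
set L := ln _; have L0 : 0 <= L by apply: ln_ge0; rewrite ler1n.
(* q = n^(1/6) makes all powers integral: n = q^6, n^(5/3) = q^10, n^(4/3) = q^8. Moreover L + 1 <=
   6 q, so n (L + 1)^2 is at most 36 q^8. *)
pose q := expR (L / 6).
have q1 : 1 <= q by rewrite /q -expR0 ler_expR divr_ge0.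
have q0 : 0 < q by exact: expR_gt0.
have qX k : q ^+ k = expR (k%:R * (L / 6)) by rewrite expRM_natl.
have qn : n%:R = q ^+ 6 by rewrite qX mulrC divfK // lnK ?posrE.
have -> : expR (5 / 3 * L) = q ^+ 10 by rewrite qX; congr expR; field.
have -> : expR (- (L / 3)) = (q ^+ 2)^-1.
  by rewrite qX -expRN; congr expR; field.
have -> : (expR 1 + 37 * (q ^+ 2)^-1) * q ^+ 10 = expR 1 * q ^+ 10 + 37 * q ^+ 8.
  by field; rewrite gt_eqF.
set g := expR 1 * _ + _.
have q8 : 1 <= q ^+ 8 by exact: exprn_ege1.
have e0 : 0 < expR 1 * q ^+ 10 by rewrite mulr_gt0 ?expR_gt0 ?exprn_gt0.
have g0 : 0 <= g by rewrite /g; lra.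
have /andP[mg gm] := truncn_itv g0; set m := Num.trunc g in mg gm.
rewrite -natr1 in gm.
have m0 : (0 < m)%N by rewrite lt0n; apply/eqP => m0; move: gm; rewrite m0 /g; lra.
(* If m exceeds n^2, the claimed lower bound is negative or zero. *)
have [mn|nm] := leqP m (n ^ 2); last first.
  apply: le_trans (ler0n _ _); rewrite subr_le0; apply: le_trans mg.
  by rewrite -natrX ler_nat ltnW.
have Lq : L + 1 <= 6 * q.
  have : L / 6 <= q - 1 by rewrite lerBrDl expR_ge1Dx.
  lra.
have Lq2 : (L + 1) ^+ 2 <= 36 * q ^+ 2.
  have -> : 36 * q ^+ 2 = (6 * q) ^+ 2 by ring.
  by apply: lerXn2r => //; rewrite nnegrE; lra.
have m0' : 0 < m%:R :> R by rewrite ltr0n.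
(* Tangent bound for ln at m = e q^10, where 3 ln m - 5 L - 3 vanishes. *)
have hln : 1 + 10 * (L / 6) - ln m%:R <= expR 1 * q ^+ 10 / m%:R - 1.
  apply: le_trans (ln_le_sub1 (divr_gt0 e0 m0')).
  rewrite ln_div ?posrE // lnM ?posrE ?expR_gt0 ?exprn_gt0 // expRK qX expRK.
  by [].
have hm : 3 * (m%:R - expR 1 * q ^+ 10) <= m%:R * (3 * ln m%:R - 5 * L - 3).
  have := ler_wpM2l (ltW m0') hln.
  have -> : m%:R * (expR 1 * q ^+ 10 / m%:R - 1) = expR 1 * q ^+ 10 - m%:R.
    by field; rewrite gt_eqF.
  lra.
(* Of the constant 37, 36 absorbs (L + 1)^2 and 1 the truncation of g to m. *)
have hlt : 3 * n%:R * (L + 1) ^+ 2 < m%:R * (3 * ln m%:R - 5 * L - 3).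
  apply: lt_le_trans hm; apply: (@le_lt_trans _ _ (108 * q ^+ 8)).
    have -> : 108 * q ^+ 8 = 3 * q ^+ 6 * (36 * q ^+ 2) by ring.
    by rewrite qn ler_wpM2l // mulr_ge0 ?exprn_ge0 ?ltW.
  move: gm; rewrite /g; lra.
have := @RTD_gt R n n0 m; rewrite m0 mn => /(_ isT hlt) h.
apply: (@le_trans _ _ (n ^ 2 - m)%:R); last by rewrite ler_nat ltnW.
by rewrite natrB // natrX lerB.
Qed.

Theorem theorem3 (R : realType) :
  exists2 o : nat -> R, o n @[n --> \oo] --> (0 : R) &
    forall n : nat, (0 < n)%N ->
      (n%:R : R) ^+ 2 - (expR 1 + o n) * (n%:R : R) `^ (5%:R / 3%:R)
        <= (RTD (latin_squares n))%:R.
Proof.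
(* This is 37 n^(-1/3). *)
exists (fun n => 37 * expR (- (ln n%:R / 3))) => [|n n0].
  rewrite -[X in _ --> X](mulr0 (37 : R)); apply: cvgM; first exact: cvg_cst.
  apply: (@cvg_comp _ _ _ (fun n : nat => ln n%:R / 3 : R) (fun x => expR (- x)) _ _ _ _ (@cvgr_expR R)).
  apply/cvgryPge => A; near=> n.
  have hA : expR (3 * A) <= n%:R by near: n; exact: nbhs_infty_ger.
  rewrite ler_pdivlMr // mulrC -ler_expR lnK //.
  by rewrite posrE; apply: lt_le_trans hA; exact: expR_gt0.
rewrite /powR pnatr_eq0 gtn_eqF //; exact: RTD_latin_squares_ge.
Unshelve. all: by end_near. Qed.
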